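(* Let $I$ be a $k$-subset of $\{1,\dots,n\}$ such that $\Omega(L_I)$ has rank $1$, i.e. $I$ is, cyclically, a disjoint union of exactly two maximal cyclic intervals $A_1,A_2$ (listed in cyclic order). Let $d_i=|A_i|$, let $l_1$ be the number of elements of $\{1,\dots,n\}\setminus I$ lying cyclically between $A_1$ and $A_2$, and $l_2$ the number lying cyclically between $A_2$ and $A_1$. Write $(n,k)=\gcd(n,k)$, let $t$ range over the positive integers, and let the minimum of an empty set be $+\infty$. Then the period $m$ of $L_I$ is: (1) if $d_1\ne d_2$ and $l_1\neq l_2$: $m=2n/(n,k)$; (2) if $d_1=d_2$ and $l_1\ne l_2$: $m=\min\{\,2n/(n,k),\ 2\min\{t: d_1+tk\equiv 0 \bmod n\}+1\,\}$; (3) if $d_1\neq d_2$ and $l_1=l_2$: $m=\min\{\,2n/(n,k),\ 2\min\{t: tk-l_2\equiv 0 \bmod n\}+1\,\}$; (4) if $d_1=d_2$ and $l_1=l_2$: $m$ is the minimum of the four numbers $2n/(n,k)$, $\;2\min\{t: tk-l_2\equiv 0\bmod n\}+1$, $\;2\min\{t: d_1+tk\equiv 0\bmod n\}+1$, $\;2\min\{t: d_1+l_1+tk\equiv 0\bmod n\}$.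
   Context: Let $\mathbb F$ be an algebraically closed field, and let $n\ge 2$ and $1\le k\le n-1$ be integers. Elements of $\{1,\dots,n\}$ are read modulo $n$. Let $B$ be the quotient of the path algebra over $\mathbb F$ of the quiver with vertex set $\mathbb Z_n$ and arrows $x_i:i-1\to i$, $y_i:i\to i-1$ ($i\in\mathbb Z_n$) by the relations $xy=yx$ and $x^k=y^{n-k}$, one of each kind starting at every vertex (that is, $x_iy_i=y_{i+1}x_{i+1}$ at vertex $i$, paths composed as functions, and the length-$k$ path of $x$'s from $i$ to $i+k$ equals the length-$(n-k)$ path of $y$'s from $i$ to $i+k$). Its centre is $Z=\mathbb F[t]$, $t=\sum_i x_iy_i$ (not to be confused with the integer $t$ in the claim). Modules are left modules, i.e. representations of the quiver. The rank of a $B$-module $M$ is the length of $M\otimes_Z K$ over $B\otimes_Z K\cong M_n(K)$, $K$ being the fraction field of $Z$. For a $k$-subset $I\subseteq\{1,\dots,n\}$, the rank $1$ module $L_I$ has a copy $U_i=\mathbb F[t]$ at each vertex $i$; $x_i:U_{i-1}\to U_i$ is multiplication by $1$ if $i\in I$ and by $t$ if $i\notin I$; $y_i:U_i\to U_{i-1}$ is multiplication by $t$ if $i\in I$ and by $1$ if $i\notin I$. Every rank $1$ module that is free over $Z$ is isomorphic to $L_I$ for a unique $I$. Put $P_j=Be_j$. Syzygies. Let $U=\{u\notin I: u+1\in I\}$ (peaks) and $V=\{v\in I: v+1\notin I\}$ (valleys). The projective cover of $L_I$ is $\pi:\bigoplus_{u\in U}P_u\to L_I$, $e_u\mapsto 1\in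 U_u$, and $\Omega(L_I)=\ker\pi$ has rank $|U|-1$. Assume $|U|\ge2$. Then $\Omega(L_I)$ is the image of $D:\bigoplus_{v\in V}P_v\to\bigoplus_{u\in U}P_u$ sending $e_v$ to $x^{v-u_-}-y^{u_+-v}$, where $u_-$ and $u_+$ are the elements of $U$ immediately preceding and following $v$ in cyclic order, $x^{v-u_-}\in P_{u_-}$ is the path of $x$'s from $u_-$ to $v$, and $y^{u_+-v}\in P_{u_+}$ is the path of $y$'s from $u_+$ to $v$. Put $\Omega^2(L_I)=\ker D$. This is again a rank $1$ module free over $Z$, hence isomorphic to some $L_{I'}$, so the construction is iterated: $\Omega^1=\Omega$, $\Omega^{m+2}(L_I)=\Omega^m(\Omega^2(L_I))$. Splicing gives the minimal projective resolution of $L_I$. The period of $L_I$ is the smallest $m\ge1$ with $\Omega^m(L_I)\cong L_I$. *)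

(* Defs.v *)
From HB Require Import structures.
From mathcomp Require Import all_boot all_order all_algebra.
From mathcomp Require Import finmap generic_quotient ring_quotient.
From mathcomp Require Import boolp zify.
From mathcomp.multinomials Require Import monalg.

Set Implicit Arguments.
Unset Strict Implicit.
Unset Printing Implicit Defensive.

Import GRing.Theory.
Local Open Scope ring_scope.
Local Open Scope quotient_scope.

(* A left B-module is an F-vector space M with the actions of the vertex
   idempotents e_i and of x = \sum_i x_i and y = \sum_i y_i.  The arrow
   x_i : i-1 -> i acts as the restriction of x to e_(i-1) M, and
   y_i : i -> i-1 as the restriction of y to e_i M.  So M is the
   representation of the quiver with the space e_i M at vertex i, and the laws
   [vxyC] and [vxkE] impose the two relations at every vertex.
   The vertex set 'Z_n is Z/2 for n = 0, 1: everything below that depends on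
   the size of 'Z_n has 1 < n as a hypothesis. *)

Record bmod (F : fieldType) (n k : nat) := BMod {
  bmod_sort :> lmodType F;
  ve : 'Z_n -> {linear bmod_sort -> bmod_sort};
  vx : {linear bmod_sort -> bmod_sort};
  vy : {linear bmod_sort -> bmod_sort};
  ve_orth : forall i j m, ve i (ve j m) = if i == j then ve j m else 0;
  ve_sum : forall m, \sum_i ve i m = m;
  vx_ve : forall i m, vx (ve i m) = ve (i + 1) (vx m);
  vy_ve : forall i m, vy (ve i m) = ve (i - 1) (vy m);
  vxyC : forall m, vx (vy m) = vy (vx m);
  vxkE : forall m, iter k vx m = iter (n - k) vy m
}.

Definition bhom (F : fieldType) (n k : nat) (M N : bmod F n k)
    (f : {linear M -> N}) : Prop :=
  [/\ forall i m, f (ve M i m) = ve N i (f m),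
      forall m, f (vx M m) = vx N (f m) &
      forall m, f (vy M m) = vy N (f m)].

Definition biso (F : fieldType) (n k : nat) (M N : bmod F n k) : Prop :=
  exists2 f : {linear M -> N}, bhom f & bijective f.

Section Kernel.
Variables (F : fieldType) (V W : lmodType F) (f : {linear V -> W}).

Definition in_ker : {pred V} := [pred v | f v == 0].

Record kernel := Kernel { ker_val : V; ker_valP : ker_val \in in_ker }.

Lemma in_ker_submod : submod_closed in_ker.
Proof.
split=> [|a u v]; rewrite !inE ?linear0 // => /eqP u0 /eqP v0.
by rewrite linearP u0 v0 scaler0 addr0.
Qed.

HB.instance Definition _ := GRing.isSubmodClosed.Build F V in_ker in_ker_submod.
HB.instance Definition _ := [isSub for ker_val].
HB.instance Definition _ := [Choice of kernel by <:].
HB.instance Definition _ := [SubChoice_isSubLmodule of kernel by <:].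

Section Restrict.
Variables (g : {linear V -> V}) (gk : forall v, f v = 0 -> f (g v) = 0).

Lemma ker_restr_subproof (v : kernel) : g (ker_val v) \in in_ker.
Proof. by rewrite inE; apply/eqP/gk/eqP; case: v. Qed.

Definition ker_fun (v : kernel) : kernel := Kernel (ker_restr_subproof v).

Lemma ker_fun_linear : linear ker_fun.
Proof. by move=> a u v; apply: val_inj; rewrite /= !linearP. Qed.

Definition ker_restr : {linear kernel -> kernel} :=
  HB.pack ker_fun (GRing.isLinear.Build _ _ _ _ ker_fun ker_fun_linear).

End Restrict.
End Kernel.

Section KernelModule.
Variables (F : fieldType) (n k : nat) (M N : bmod F n k).
Variables (f : {linear M -> N}) (fB : bhom f).

Lemma ker_ve i m : f m = 0 -> f (ve M i m) = 0.
Proof. by case: fB => fe _ _ fm; rewrite fe fm linear0. Qed.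

Lemma ker_vx m : f m = 0 -> f (vx M m) = 0.
Proof. by case: fB => _ fx _ fm; rewrite fx fm linear0. Qed.

Lemma ker_vy m : f m = 0 -> f (vy M m) = 0.
Proof. by case: fB => _ _ fy fm; rewrite fy fm linear0. Qed.

Lemma val_ker_sum (I : Type) (r : seq I) (G : I -> kernel f) :
  ker_val (\sum_(i <- r) G i) = \sum_(i <- r) ker_val (G i).
Proof. exact: (raddf_sum (val : kernel f -> M)). Qed.

Lemma val_ker_iter (g : {linear M -> M}) gk p (m : kernel f) :
  ker_val (iter p (@ker_restr F M N f g gk) m) = iter p g (ker_val m).
Proof. by elim: p => //= p ->. Qed.

Definition bker : bmod F n k.
Proof.
refine (@BMod F n k (kernel f) (fun i => ker_restr (@ker_ve i))
  (ker_restr ker_vx) (ker_restr ker_vy) _ _ _ _ _ _).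
- by move=> i j m; apply: val_inj => /=; rewrite ve_orth; case: eqP.
- by move=> m; apply: val_inj; rewrite /= val_ker_sum /= ve_sum.
- by move=> i m; apply: val_inj; rewrite /= vx_ve.
- by move=> i m; apply: val_inj; rewrite /= vy_ve.
- by move=> m; apply: val_inj; rewrite /= vxyC.
- by move=> m; apply: val_inj; rewrite /= !val_ker_iter vxkE.
Defined.

End KernelModule.

Lemma lcompE (F : fieldType) (U V W : lmodType F) (f : {linear V -> W})
    (g : {linear U -> V}) (u : U) : (f \o g : {linear U -> W}) u = f (g u).
Proof. by []. Qed.

(* From every vertex there is exactly one arrow x and one arrow y, so a path
   starting at j is a word in the letters x = [true] and y = [false].  Paths are
   composed as functions, so the leftmost letter is the arrow followed last.
   Hence the paths starting at j span [{malg F[seq bool]}], whatever j is, and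
   B e_j is its quotient by the span of the differences p - q, where p and q
   are obtained from each other by applying one relation inside a path. *)

Local Notation ax := true.
Local Notation ay := false.

Definition endpt (n : nat) (j : 'Z_n) (w : seq bool) : 'Z_n :=
  foldr (fun (c : bool) i => if c then i + 1 else i - 1) j w.
Arguments endpt n j w : clear implicits.

Section Relations.
Variables (F : fieldType) (n k : nat).

Inductive relpair : seq bool -> seq bool -> Prop :=
| Rel_comm u v : relpair (u ++ [:: ax; ay] ++ v) (u ++ [:: ay; ax] ++ v)
| Rel_pow u v : relpair (u ++ nseq k ax ++ v) (u ++ nseq (n - k) ay ++ v).

Inductive relspan : {malg F[seq bool]} -> Prop :=
| Relspan0 : relspan 0
| RelspanD c p q a of relpair p q & relspan a :
    relspan (c *: (<< p >> - << q >>) + a).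

Definition in_relspan : {pred {malg F[seq bool]}} := fun a => `[< relspan a >].

Lemma in_relspan_submod : submod_closed in_relspan.
Proof.
split=> [|c a b]; first by apply/asboolP; exact: Relspan0.
move=> /asboolP aR /asboolP bR; apply/asboolP; elim: aR => [|d p q a' pq _ IH].
  by rewrite scaler0 add0r.
by rewrite scalerDr scalerA -addrA; exact: RelspanD.
Qed.

HB.instance Definition _ :=
  GRing.isSubmodClosed.Build F {malg F[seq bool]} in_relspan in_relspan_submod.

Definition proj_sort : Type := Quotient.quot in_relspan.

HB.instance Definition _ := Choice.on proj_sort.
HB.instance Definition _ := GRing.Zmodule.on proj_sort.
HB.instance Definition _ := EqQuotient.on proj_sort.
HB.instance Definition _ := ZmodQuotient.on proj_sort.

Definition proj_scale (c : F) (a : proj_sort) : proj_sort :=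
  \pi_proj_sort (c *: repr a).

Lemma pi_eqP (a b : {malg F[seq bool]}) :
  reflect (\pi_proj_sort a = \pi_proj_sort b) (a - b \in in_relspan).
Proof. by rewrite (Quotient.idealrBE in_relspan a b); exact: eqP. Qed.

Lemma pi_scale c (a : {malg F[seq bool]}) :
  \pi_proj_sort (c *: a) = proj_scale c (\pi_proj_sort a).
Proof.
rewrite /proj_scale; apply/pi_eqP; rewrite -scalerBr; apply: rpredZ.
by apply/pi_eqP; rewrite reprK.
Qed.

Lemma pi_add (a b : {malg F[seq bool]}) :
  \pi_proj_sort (a + b) = \pi_proj_sort a + \pi_proj_sort b.
Proof. by rewrite raddfD. Qed.

Lemma proj_scaleA c d a : proj_scale c (proj_scale d a) = proj_scale (c * d) a.
Proof.
by rewrite -[a]reprK -(pi_scale d) -(pi_scale c) -(pi_scale (c * d)) scalerA.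
Qed.

Lemma proj_scale1 : left_id 1 proj_scale.
Proof. by move=> a; rewrite -[a]reprK -(pi_scale 1) scale1r. Qed.

Lemma proj_scaleDr : right_distributive proj_scale +%R.
Proof.
move=> c a b; rewrite -[a]reprK -[b]reprK.
by rewrite -pi_add -(pi_scale c) scalerDr pi_add !pi_scale.
Qed.

Lemma proj_scaleDl a : {morph proj_scale^~ a : c d / c + d}.
Proof. by move=> c d /=; rewrite -[a]reprK -pi_scale scalerDl pi_add !pi_scale. Qed.

HB.instance Definition _ := GRing.Zmodule_isLmodule.Build F proj_sort
  proj_scaleA proj_scale1 proj_scaleDr proj_scaleDl.

Definition pw (w : seq bool) : proj_sort := \pi_proj_sort << w >>.

Lemma pw_rel p q : relpair p q -> pw p = pw q.
Proof.
move=> pq; apply/pi_eqP; apply/asboolP.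
by rewrite -[_ - _]addr0 -[_ - _]scale1r; apply: RelspanD => //; exact: Relspan0.
Qed.

(* [pext] is the linear map sending the class of w to h w. *)

Section Extension.
Variables (V : lmodType F) (h : seq bool -> V).

Definition mext (a : {malg F[seq bool]}) : V := \sum_(w <- msupp a) a@_w *: h w.

Lemma mextEw (d : {fset seq bool}) (a : {malg F[seq bool]}) :
  (msupp a `<=` d)%fset -> mext a = \sum_(w <- d) a@_w *: h w.
Proof.
move=> le_d; rewrite /mext (big_fset_incl _ le_d) // => w _ /mcoeff_outdom ->.
by rewrite scale0r.
Qed.

Lemma mext_linear : linear mext.
Proof.
move=> c a b; pose d := (msupp (c *: a + b) `|` (msupp a `|` msupp b))%fset.
have [dS da db] : [/\ msupp (c *: a + b) `<=` d, msupp a `<=` d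
                     & msupp b `<=` d]%fset.
  by rewrite /d fsubsetUl; split=> //; rewrite fsubsetU // ?(fsubsetUl, fsubsetUr) orbT.
rewrite (mextEw dS) (mextEw da) (mextEw db).
rewrite scaler_sumr -big_split /=; apply: eq_bigr => w _.
by rewrite mcoeffD mcoeffZ scalerDl scalerA.
Qed.

HB.instance Definition _ :=
  GRing.isLinear.Build F {malg F[seq bool]} V *:%R mext mext_linear.

Lemma mextU w : mext << w >> = h w.
Proof.
by rewrite (mextEw (msuppU_le (x := 1))) big_seq_fset1 mcoeffUU scale1r.
Qed.

Hypothesis hR : forall p q, relpair p q -> h p = h q.

Lemma mext_relspan a : a \in in_relspan -> mext a = 0.
Proof.
move=> /asboolP; elim=> [|c p q b pq _ IH]; first exact: linear0.
by rewrite mext_linear IH linearB /= !mextU (hR pq) subrr scaler0 addr0.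
Qed.

Definition pext_fun (a : proj_sort) : V := mext (repr a).

Lemma pext_pi a : pext_fun (\pi_proj_sort a) = mext a.
Proof.
apply/eqP; rewrite -subr_eq0 /pext_fun -linearB /=; apply/eqP/mext_relspan.
by apply/pi_eqP; rewrite reprK.
Qed.

Lemma pext_linear : linear pext_fun.
Proof.
move=> c a b; rewrite -[a]reprK -[b]reprK -[c *: _]pi_scale -pi_add !pext_pi.
by rewrite linearP.
Qed.

Definition pext : {linear proj_sort -> V} :=
  HB.pack pext_fun (GRing.isLinear.Build _ _ _ _ pext_fun pext_linear).

Lemma pextE w : pext (pw w) = h w.
Proof. by rewrite /pext /= pext_pi mextU. Qed.

End Extension.

Lemma proj_ind (V : lmodType F) (f g : {linear proj_sort -> V}) :
  (forall w, f (pw w) = g (pw w)) -> f =1 g.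
Proof.
move=> fg a; rewrite -[a]reprK; move: (repr a) => a0.
have -> : \pi_proj_sort a0 = \sum_(w <- msupp a0) a0@_w *: pw w.
  rewrite {1}[a0]monalgE raddf_sum; apply: eq_bigr => w _ /=.
  rewrite -[RHS]pi_scale; congr (\pi _); apply/malgP => v.
  by rewrite mcoeffZ !mcoeffU mulr_natr.
rewrite !linear_sum /=; apply: eq_bigr => w _.
by rewrite !linearZ /= fg.
Qed.

End Relations.

Section Projectives.
Variables (F : fieldType) (n k : nat) (hn : (1 < n)%N).
Local Notation P := (proj_sort F n k).

Lemma relpair_cons c p q : relpair n k p q -> relpair n k (c :: p) (c :: q).
Proof. by case=> u v; [exact: (Rel_comm n k (c :: u))|exact: (Rel_pow n k (c :: u))]. Qed.

Lemma endpt_X j m w : endpt n j (nseq m ax ++ w) = endpt n j w + m%:R :> 'Z_n.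
Proof. by elim: m => [|m IH] /=; rewrite ?addr0 // IH -addrA natr1. Qed.

Lemma endpt_Y j m w : endpt n j (nseq m ay ++ w) = endpt n j w - m%:R :> 'Z_n.
Proof. by elim: m => [|m IH] /=; rewrite ?subr0 // IH -addrA -opprD natr1. Qed.

Lemma natr_n : n%:R = 0 :> 'Z_n.
Proof. by apply: val_inj; rewrite /= val_Zp_nat // modnn. Qed.

Hypothesis hk : (0 < k < n)%N.

Lemma endpt_rel j p q : relpair n k p q -> endpt n j p = endpt n j q.
Proof.
have tail u : forall v w, endpt n j v = endpt n j w ->
    endpt n j (u ++ v) = endpt n j (u ++ w).
  by move=> v w vw; elim: u => //= c u ->.
case=> u v; apply: tail; first by rewrite /= subrK addrK.
by rewrite endpt_X endpt_Y natrB ?natr_n ?(ltnW (andP hk).2) //  sub0r opprK.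
Qed.

Definition act (M : bmod F n k) (m : M) (w : seq bool) : M :=
  foldr (fun (c : bool) => if c then vx M else vy M) m w.

Lemma act_X (M : bmod F n k) (m : M) p w :
  act m (nseq p ax ++ w) = iter p (vx M) (act m w).
Proof. by elim: p => //= p ->. Qed.

Lemma act_Y (M : bmod F n k) (m : M) p w :
  act m (nseq p ay ++ w) = iter p (vy M) (act m w).
Proof. by elim: p => //= p ->. Qed.

Lemma act_rel (M : bmod F n k) (m : M) p q :
  relpair n k p q -> act m p = act m q.
Proof.
have tail u : forall v w, act m v = act m w -> act m (u ++ v) = act m (u ++ w).
  by move=> v w vw; elim: u => //= c u ->.
case=> u v; apply: tail; first by rewrite /= vxyC.
by rewrite act_X act_Y vxkE.
Qed.

Lemma pe_subproof (i j : 'Z_n) p q : relpair n k p q ->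
  (if endpt n j p == i then pw F n k p else 0) =
  (if endpt n j q == i then pw F n k q else 0).
Proof. by move=> pq; rewrite (endpt_rel j pq) (pw_rel F pq). Qed.

Lemma pcons_subproof c p q : relpair n k p q ->
  pw F n k (c :: p) = pw F n k (c :: q).
Proof. by move=> pq; apply/pw_rel/relpair_cons. Qed.

(* The underlying vector space of P_j = B e_j and the actions [pcons] of x and y
   do not depend on j; the action [pe j i] of e_i does. *)
Definition pe (j i : 'Z_n) : {linear P -> P} := pext (@pe_subproof i j).
Definition pcons (c : bool) : {linear P -> P} := pext (@pcons_subproof c).

Lemma peE j i w : pe j i (pw F n k w) = if endpt n j w == i then pw F n k w else 0.
Proof. exact: pextE. Qed.

Lemma pconsE c w : pcons c (pw F n k w) = pw F n k (c :: w).
Proof. exact: pextE. Qed.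

Lemma pe_orth j i i' a : pe j i (pe j i' a) = if i == i' then pe j i' a else 0.
Proof.
pose g : {linear P -> P} := if i == i' then pe j i' else \0.
have -> : (if i == i' then pe j i' a else 0) = g a by rewrite /g; case: eqP.
apply: (@proj_ind F n k _ (pe j i \o pe j i') g) => w; rewrite lcompE peE.
case: (eqVneq (endpt n j w) i') => wi'.
  by rewrite peE wi' eq_sym /g; case: eqP => // _; rewrite peE wi' eqxx.
by rewrite linear0 /g; case: eqP => // _; rewrite peE (negPf wi').
Qed.

Lemma pe_sum j a : \sum_i pe j i a = a.
Proof.
pose g b := \sum_i pe j i b.
have gL : linear g.
  by move=> c b d; rewrite /g scaler_sumr -big_split; apply: eq_bigr => i _; rewrite linearP.
pose gl : {linear P -> P} := HB.pack g (GRing.isLinear.Build _ _ _ _ g gL).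
apply: (@proj_ind F n k _ gl idfun) => w.
have -> : gl (pw F n k w) = \sum_i pe j i (pw F n k w) by [].
rewrite (bigD1 (endpt n j w)) // peE eqxx big1 => [|i]; first exact: addr0.
by rewrite eq_sym peE => /negPf ->.
Qed.

Lemma pcons_pe c j i a :
  pcons c (pe j i a) = pe j (if c then i + 1 else i - 1) (pcons c a).
Proof.
apply: (@proj_ind F n k _ (pcons c \o pe j i) (pe j _ \o pcons c)) => w.
rewrite !lcompE peE !pconsE peE [endpt n j (c :: w)]/=.
by case: c; rewrite (inj_eq (addIr _)); case: eqP => _; rewrite ?pconsE ?linear0.
Qed.

Lemma pcons_comm a : pcons ax (pcons ay a) = pcons ay (pcons ax a).
Proof.
apply: (@proj_ind F n k _ (pcons ax \o pcons ay) (pcons ay \o pcons ax)) => w.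
by rewrite !lcompE !pconsE; apply: pw_rel; exact: (Rel_comm n k [::] w).
Qed.

Lemma iter_linear (V : lmodType F) (f : {linear V -> V}) m : linear (iter m f).
Proof.
elim: m => [|m IH] c u v; first by [].
by rewrite !iterS; move: (IH c u v) => /= ->; rewrite linearP.
Qed.

Lemma pcons_pow a : iter k (pcons ax) a = iter (n - k) (pcons ay) a.
Proof.
have itE c m w : iter m (pcons c) (pw F n k w) = pw F n k (nseq m c ++ w).
  by elim: m => // m IH; rewrite iterS IH pconsE.
pose il c m : {linear P -> P} := HB.pack (iter m (pcons c))
  (GRing.isLinear.Build _ _ _ _ (iter m (pcons c)) (iter_linear (pcons c) m)).
apply: (@proj_ind F n k _ (il ax k) (il ay (n - k)%N)) => w.
have ilE c m : il c m (pw F n k w) = iter m (pcons c) (pw F n k w) by [].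
rewrite !ilE !itE.
by apply: pw_rel; exact: (Rel_pow n k [::] w).
Qed.

Section FfMap.
Variables (T : finType) (V : lmodType F) (g : T -> {linear V -> V}).

Definition ffmap_fun (f : {ffun T -> V}) : {ffun T -> V} := [ffun s => g s (f s)].

Lemma ffmap_linear : linear ffmap_fun.
Proof. by move=> c a b; apply/ffunP => s; rewrite !ffunE linearP. Qed.

Definition ffmap : {linear {ffun T -> V} -> {ffun T -> V}} :=
  HB.pack ffmap_fun (GRing.isLinear.Build _ _ _ _ ffmap_fun ffmap_linear).

Lemma ffmapE f s : ffmap f s = g s (f s). Proof. by rewrite /ffmap /= ffunE. Qed.

End FfMap.

Lemma iter_ffmap (T : finType) (V : lmodType F) (g : {linear V -> V}) m
    (f : {ffun T -> V}) s :
  iter m (ffmap (fun=> g)) f s = iter m g (f s).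
Proof. by elim: m => //= m IH; rewrite ffunE IH. Qed.

(* The direct sum of the P_j for j in S. *)
Definition psum (S : {set 'Z_n}) : bmod F n k.
Proof.
pose T := {j | j \in S}.
refine (@BMod F n k {ffun T -> P} (fun i => ffmap (fun j : T => pe (val j) i))
  (ffmap (fun=> pcons ax)) (ffmap (fun=> pcons ay)) _ _ _ _ _ _).
- by move=> i j m; apply/ffunP => s; rewrite !ffmapE pe_orth;
    case: eqP; rewrite ?ffmapE ?ffunE.
- move=> m; apply/ffunP => s; rewrite sum_ffunE -[RHS](pe_sum (val s)).
  by apply: eq_bigr => i _; rewrite ffmapE.
- by move=> i m; apply/ffunP => s; rewrite !ffmapE pcons_pe.
- by move=> i m; apply/ffunP => s; rewrite !ffmapE pcons_pe.
- by move=> m; apply/ffunP => s; rewrite !ffmapE pcons_comm.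
- by move=> m; apply/ffunP => s; rewrite !iter_ffmap pcons_pow.
Defined.

(* The homomorphism sending e_j to g j for all j in S. *)

Section FromProj.
Variables (S : {set 'Z_n}) (M : bmod F n k) (g : 'Z_n -> M).

Definition psum_hom_fun (f : psum S) : M :=
  \sum_(j : {j | j \in S})
     pext (@act_rel M (g (val j))) ((f : {ffun _ -> P}) j).

Lemma psum_hom_linear : linear psum_hom_fun.
Proof.
move=> c a b; rewrite /psum_hom_fun scaler_sumr -big_split /=.
apply: eq_bigr => j _; rewrite !ffunE.
exact: (pext_linear (@act_rel M (g (val j)))).
Qed.

Definition psum_hom : {linear psum S -> M} :=
  HB.pack psum_hom_fun (GRing.isLinear.Build _ _ _ _ psum_hom_fun psum_hom_linear).

Lemma ve_act i j m w : ve M j m = m ->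
  ve M i (act m w) = if endpt n j w == i then act m w else 0.
Proof.
move=> mj; elim: w i => [|[] w IH] i /=.
- by rewrite -mj ve_orth eq_sym.
- rewrite -[in LHS](subrK 1 i) -vx_ve IH eq_sym subr_eq eq_sym.
  by case: eqP => // _; rewrite linear0.
rewrite -[in LHS](addrK 1 i) -vy_ve IH -subr_eq.
by case: eqP => // _; rewrite linear0.
Qed.

Lemma psum_homE (f : psum S) :
  psum_hom f = \sum_(j : {j | j \in S})
    pext (@act_rel M (g (val j))) ((f : {ffun _ -> P}) j).
Proof. by []. Qed.

Lemma psum_homB : (forall j, j \in S -> ve M j (g j) = g j) -> bhom psum_hom.
Proof.
move=> gE; split=> [i||] f; rewrite !psum_homE linear_sum;
  apply: eq_bigr => -[j jS] _; rewrite ffmapE; move: (f _) => a;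
  pose h := pext (@act_rel M (g j)).
- apply: (@proj_ind F n k _ (h \o pe j i) (ve M i \o h)) => w.
  rewrite !lcompE peE /h !pextE (ve_act _ _ (gE j jS)).
  by case: eqP; rewrite ?pextE ?linear0.
- apply: (@proj_ind F n k _ (h \o pcons ax) (vx M \o h)) => w.
  by rewrite !lcompE pconsE /h !pextE.
- apply: (@proj_ind F n k _ (h \o pcons ay) (vy M \o h)) => w.
  by rewrite !lcompE pconsE /h !pextE.
Qed.

End FromProj.
End Projectives.

Definition ksubset (n k : nat) := {I : {set 'Z_n} | #|I| == k}.

(* The copy of F[t] in L_I at vertex i is the i-th component of a finite function. *)

Section RankOne.
Variables (F : fieldType) (n k : nat) (hn : (1 < n)%N) (hk : (0 < k < n)%N).
Variable I : ksubset n k.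
Local Notation L := {ffun 'Z_n -> {poly F}}.

(* x_i multiplies by [xcoef i], and y_i by [ycoef i]. *)
Definition xcoef (i : 'Z_n) : {poly F} := if i \in val I then 1 else 'X.
Definition ycoef (i : 'Z_n) : {poly F} := if i \in val I then 'X else 1.

Definition Le_fun (i : 'Z_n) (f : L) : L := [ffun j => if j == i then f j else 0].
Definition Lx_fun (f : L) : L := [ffun i => xcoef i * f (i - 1)].
Definition Ly_fun (f : L) : L := [ffun i => ycoef (i + 1) * f (i + 1)].

Lemma Le_linear i : linear (Le_fun i).
Proof.
move=> c f g; apply/ffunP => j; rewrite !ffunE.
by case: eqP; rewrite // scaler0 addr0.
Qed.

Lemma Lx_linear : linear Lx_fun.
Proof. by move=> c f g; apply/ffunP => j; rewrite !ffunE mulrDr scalerAr. Qed.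

Lemma Ly_linear : linear Ly_fun.
Proof. by move=> c f g; apply/ffunP => j; rewrite !ffunE mulrDr scalerAr. Qed.

Definition Le i : {linear L -> L} :=
  HB.pack (Le_fun i) (GRing.isLinear.Build _ _ _ _ (Le_fun i) (Le_linear i)).
Definition Lx : {linear L -> L} :=
  HB.pack Lx_fun (GRing.isLinear.Build _ _ _ _ Lx_fun Lx_linear).
Definition Ly : {linear L -> L} :=
  HB.pack Ly_fun (GRing.isLinear.Build _ _ _ _ Ly_fun Ly_linear).

Lemma iter_Lx m f i :
  iter m Lx f i = 'X^(\sum_(s < m) ((i - s%:R)%R \notin val I)) * f (i - m%:R).
Proof.
elim: m i => [|m IH] i; first by rewrite big_ord0 mul1r subr0.
rewrite iterS [LHS]ffunE IH big_ord_recl exprD mulrA subr0.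
have -> : i - 1 - m%:R = i - m.+1%:R by rewrite -addrA -opprD nat1r.
congr (_ * _ * _); first by rewrite /xcoef; case: (i \in _).
congr ('X^_); apply: eq_bigr => s _ /=.
by rewrite -addrA -opprD nat1r.
Qed.

Lemma iter_Ly m f i :
  iter m Ly f i = 'X^(\sum_(s < m) ((i + s.+1%:R)%R \in val I)) * f (i + m%:R).
Proof.
elim: m i => [|m IH] i; first by rewrite big_ord0 mul1r addr0.
rewrite iterS [LHS]ffunE IH big_ord_recl exprD mulrA.
have -> : i + 1 + m%:R = i + m.+1%:R by rewrite -addrA nat1r.
congr (_ * _ * _); first by rewrite /ycoef; case: (_ \in _).
congr ('X^_); apply: eq_bigr => s _ /=.
by rewrite -addrA nat1r.
Qed.

Lemma sum_mem_I (i : 'Z_n) : (\sum_(s < n) ((i + s.+1%:R)%R \in val I) = k)%N.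
Proof.
transitivity (\sum_(j : 'Z_n) (j \in val I))%N; last first.
  by rewrite -big_mkcond /= sum1_card; exact: (eqP (valP I)).
have bij : bijective (fun j : 'Z_n => i + 1 + j).
  by exists (fun j => j - (i + 1)) => j; rewrite ?subrK // addrC ?addKr ?addrK ?subrK.
rewrite [RHS](reindex _ (onW_bij _ bij)) /=.
rewrite -(big_mkord xpredT (fun s => ((i + s.+1%:R)%R \in val I) : nat)).
have castE (h : nat -> nat) m : m = n ->
    (\sum_(0 <= s < n) h s = \sum_(s < m) h s)%N by move=> ->; rewrite big_mkord.
rewrite (castE _ _ (Zp_cast hn)); apply: eq_bigr => s _.
by rewrite -addrA -[s in RHS]natr_Zp nat1r.
Qed.

Lemma L_exponents (i : 'Z_n) :
  (\sum_(s < k) ((i - s%:R)%R \notin val I) =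
   \sum_(s < n - k) ((i + s.+1%:R)%R \in val I))%N.
Proof.
have kn : (k <= n)%N := ltnW (andP hk).2.
apply/eqP; rewrite -(eqn_add2r (\sum_(s < k) ((i - s%:R)%R \in val I))).
rewrite -big_split /= (eq_bigr (fun=> 1%N)) => [|s _]; last by case: (_ \in _).
rewrite sum1_card card_ord -{1}(sum_mem_I i).
rewrite -(big_mkord xpredT (fun s => ((i + s.+1%:R)%R \in val I) : nat)).
rewrite (big_cat_nat _ (n := (n - k)%N)) ?leq_subr //= big_mkord eqn_add2l.
have shiftE (h : nat -> nat) :
    (\sum_(n - k <= s < n) h s = \sum_(s < k) h (k - s.+1 + (n - k)))%N.
  by rewrite -{1}[(n - k)%N]add0n big_addn subKn // big_rev_mkord subn0.
rewrite shiftE.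
apply/eqP; apply: eq_bigr => s _.
have -> // : i + (k - s.+1 + (n - k)).+1%:R = i - s%:R.
congr (_ + _); apply/eqP; rewrite -addr_eq0 -natrD.
have -> : ((k - s.+1 + (n - k)).+1 + s = n)%N by have := ltn_ord s; lia.
by rewrite natr_n.
Qed.

Definition L_module : bmod F n k.
Proof.
refine (@BMod F n k L Le Lx Ly _ _ _ _ _ _).
- move=> i j f; apply/ffunP => s; rewrite !ffunE.
  case: (eqVneq i j) => [<-|ij]; rewrite !ffunE; first by case: eqP.
  by case: eqP => [->|//]; rewrite (negPf ij).
- move=> f; apply/ffunP => s; rewrite sum_ffunE (bigD1 s) //= !ffunE eqxx.
  by rewrite big1 ?addr0 // => j; rewrite ffunE eq_sym => /negPf ->.
- move=> i f; apply/ffunP => s; rewrite !ffunE subr_eq.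
  by case: eqP => // _; rewrite mulr0.
- move=> i f; apply/ffunP => s; rewrite !ffunE.
  have -> : (s == i - 1) = (s + 1 == i) by rewrite eq_sym subr_eq eq_sym.
  by case: eqP => // _; rewrite mulr0.
- move=> f; apply/ffunP => s; rewrite !ffunE addrK subrK !mulrA; congr (_ * _).
  by rewrite /xcoef /ycoef; do 2![case: (_ \in _)]; rewrite ?mulr1 ?mul1r.
- move=> f; apply/ffunP => s; rewrite iter_Lx iter_Ly L_exponents.
  by rewrite natrB ?natr_n ?sub0r // (ltnW (andP hk).2).
Defined.

End RankOne.

Section Syzygies.
Variables (F : fieldType) (n k : nat) (hn : (1 < n)%N) (hk : (0 < k < n)%N).

Definition peaks (I : {set 'Z_n}) : {set 'Z_n} :=
  [set u | (u \notin I) && (u + 1 \in I)].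
Definition valleys (I : {set 'Z_n}) : {set 'Z_n} :=
  [set v | (v \in I) && (v + 1 \notin I)].

(* For a valley v, the number of steps from v back to the preceding peak, and
   forward to the following one: the least s >= 0 with v -+ s a peak, which is
   positive because v is not a peak. *)
Definition back (I : {set 'Z_n}) (v : 'Z_n) : nat :=
  find (fun s => v - s%:R \in peaks I) (iota 0 n).
Definition forth (I : {set 'Z_n}) (v : 'Z_n) : nat :=
  find (fun s => v + s%:R \in peaks I) (iota 0 n).

Variable I : ksubset n k.
Local Notation L := (L_module F hn hk I).
Local Notation U := (peaks (val I)).
Local Notation V := (valleys (val I)).
Local Notation PU := (psum F hn hk U).
Local Notation PV := (psum F hn hk V).

(* The unit of the copy of F[t] at vertex u. *)
Definition L_unit (u : 'Z_n) : L := [ffun i : 'Z_n => if i == u then 1 else 0].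

Definition cover : {linear PU -> L} := @psum_hom F n k hn hk U L L_unit.

Lemma cover_hom : bhom cover.
Proof.
apply: psum_homB => j _; apply/ffunP => i; rewrite !ffunE.
by case: eqP.
Qed.

(* The element a of the summand P_j of the direct sum of the P_u. *)
Definition in_summand (j : 'Z_n) (a : proj_sort F n k) : PU :=
  [ffun s : {u | u \in U} => if val s == j then a else 0].

(* x^(v - u_-) in P_(u_-), minus y^(u_+ - v) in P_(u_+). *)
Definition Dgen (v : 'Z_n) : PU :=
  let s := back (val I) v in let r := forth (val I) v in
  in_summand (v - s%:R) (pw F n k (nseq s ax)) -
  in_summand (v + r%:R) (pw F n k (nseq r ay)).

Definition Dmap : {linear PV -> PU} := @psum_hom F n k hn hk V PU Dgen.

Lemma ve_in_summand v j w : endpt n j w = v ->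
  ve PU v (in_summand j (pw F n k w)) = in_summand j (pw F n k w).
Proof.
move=> jw; apply/ffunP => s; rewrite ffmapE !ffunE.
by case: (eqVneq (val s) j) => [->|_]; rewrite ?linear0 // peE jw eqxx.
Qed.

Lemma Dmap_hom : bhom Dmap.
Proof.
apply: psum_homB => v _; rewrite /Dgen linearB !ve_in_summand //.
- by rewrite -[nseq _ _]cats0 endpt_Y /= addrK.
- by rewrite -[nseq _ _]cats0 endpt_X /= subrK.
Qed.

Definition Omega1 : bmod F n k := bker cover_hom.
Definition Omega2 : bmod F n k := bker Dmap_hom.

End Syzygies.

(* [syzygy hn hk I m M]: the module M is Omega^m(L_I). *)
Inductive syzygy (F : fieldType) (n k : nat) (hn : (1 < n)%N) (hk : (0 < k < n)%N) :
    ksubset n k -> nat -> bmod F n k -> Prop :=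
| Syzygy1 I : syzygy hn hk I 1 (Omega1 F hn hk I)
| Syzygy2 I : syzygy hn hk I 2 (Omega2 F hn hk I)
| SyzygySS I J m M of biso (Omega2 F hn hk I) (L_module F hn hk J)
    & syzygy hn hk J m M : syzygy hn hk I m.+2 M.

(* Extended natural numbers, with [None] for +oo. *)

Definition min_pos (P : nat -> Prop) : option nat :=
  if pselect (exists m, `[< (0 < m)%N /\ P m >]) is left exP
  then Some (ex_minn exP) else None.

Definition omin (a b : option nat) : option nat :=
  match a, b with
  | Some a, Some b => Some (minn a b)
  | Some a, None => Some a
  | None, _ => b
  end.

Definition period (F : fieldType) (n k : nat) (hn : (1 < n)%N) (hk : (0 < k < n)%N)
    (I : ksubset n k) : option nat :=
  min_pos (fun m =>
    exists2 M, syzygy hn hk I m M & biso M (L_module F hn hk I)).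

Definition cint (n : nat) (a : 'Z_n) (d : nat) : {set 'Z_n} :=
  [set a + (s : nat)%:R | s : 'I_d].

(* I is the disjoint union of an interval A_1 of d1 elements starting at a and
   an interval A_2 of d2 elements; l1 elements outside I lie between A_1 and
   A_2, and l2 between A_2 and A_1.  Then I has exactly two peaks, that is,
   Omega(L_I) has rank 1. *)
Definition two_intervals (n : nat) (I : {set 'Z_n}) (a : 'Z_n)
    (d1 l1 d2 l2 : nat) : Prop :=
  [/\ [&& 0 < d1, 0 < l1, 0 < d2 & 0 < l2]%N, (d1 + l1 + d2 + l2)%N = n &
      I = cint a d1 :|: cint (a + (d1 + l1)%:R) d2].

(* Main.v *)
From HB Require Import structures.
Require Import Defs.
From mathcomp Require Import all_boot all_order all_algebra.
From mathcomp Require Import boolp zify.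

(** The theorem reduces to two explicit isomorphisms. Write I = (a, d1, l1, d2, l2)
    for the union of an interval of d1 elements starting at a, a gap of l1, an
    interval of d2 elements and a gap of l2. Then

      Omega(L_I) = L_J      with J = (a + d1, d2, l1, d1, l2),
      Omega^2(L_I) = L_(I+k) with I + k = (a + k, d1, l1, d2, l2)

    ([Omega1_iso], [Omega2_iso]). Hence Omega^(2s)(L_I) is L_(I+sk) and
    Omega^(2s+1)(L_I) is L_(J+sk) ([syzygy_shape]). As L_I determines I
    ([L_iso_inj]), the period is the least m > 0 for which the corresponding set
    equals I. A union of two nonadjacent intervals can be described by such a
    tuple in exactly two ways, which differ by the exchange of the intervals
    ([two_eq]), so each parity of m gives two congruences; those are the
    quantities of the theorem.

    For the isomorphisms, P_j is identified with L_K for the interval K of k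
    elements starting at j + 1 ([p_to_lK], [l_to_pK]); the maps between projectives
    and rank one modules that occur then multiply, at each vertex i, by a scalar
    times a power of the generator t of the centre. Let u1, u2 be the peaks of I,
    and e1 i, e2 i the exponents at i of the two components P_u1, P_u2 -> L_I of
    the projective cover. At every vertex one of them is 0 ([cover_exp_disj]),
    so the kernel at i is free on (t^(e2 i), - t^(e1 i)). How these generators
    are related by the arrows is read off from the exponents: the kernel is L_J,
    where the indicator function of J is the sum of those of the intervals of
    P_u1 and P_u2 minus that of I ([mem_syzset]).

    The map D factors as P_v1 + P_v2 -> L_J -> P_u1 + P_u2 ([Dmap_factor]). The
    second map is the inclusion of Omega(L_I), and the first one is the projective
    cover of L_J up to the sign of one generator. So the kernel of D is computed
    by the same argument applied to J, and this is why the argument is carried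
    out for covers whose generators are multiplied by nonzero scalars. *)

Set Implicit Arguments.
Unset Strict Implicit.
Unset Printing Implicit Defensive.

Import GRing.Theory.
Local Open Scope nat_scope.

(** * Least positive solutions *)

Lemma min_posP (P : nat -> Prop) (r : option nat) :
  (if r is Some m then [/\ 0 < m, P m & forall m', 0 < m' -> P m' -> m <= m']
   else forall m, 0 < m -> ~ P m) -> min_pos P = r.
Proof.
rewrite /min_pos; case: pselect => [ex|nex]; case: r => [m|] // hr.
- case: ex_minnP => m' hm min'; have [m'0 Pm'] := asboolW hm.
  case: hr => m0 Pm minm.
  congr Some; apply/eqP; rewrite eqn_leq minm // andbT min' //.
  by apply/asboolP.
- by case: ex => m hm; have [m0 Pm] := asboolW hm; case: (hr m m0).
- by case: hr => m0 Pm _; case: nex; exists m; apply/asboolP.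
Qed.

Lemma min_pos_spec (P : nat -> Prop) :
  if min_pos P is Some m
  then [/\ 0 < m, P m & forall m', 0 < m' -> P m' -> m <= m']
  else forall m, 0 < m -> ~ P m.
Proof.
rewrite /min_pos; case: pselect => [ex|nex].
  case: ex_minnP => m hm minm; have [m0 Pm] := asboolW hm; split=> // m' m'0 Pm'.
  by apply: minm; apply/asboolP.
by move=> m m0 Pm; apply: nex; exists m; apply/asboolP.
Qed.

Lemma eq_min_pos (P Q : nat -> Prop) :
  (forall m, 0 < m -> P m <-> Q m) -> min_pos P = min_pos Q.
Proof.
move=> PQ; apply: min_posP; have := min_pos_spec Q.
case: (min_pos Q) => [m [m0 Qm minm]|nQ].
  by split=> // [|m' m'0 /(PQ m' m'0)]; [exact/PQ|exact: minm].
by move=> m m0 /(PQ m m0); exact: nQ.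
Qed.

Lemma min_pos_or (P Q : nat -> Prop) :
  min_pos (fun m => P m \/ Q m) = omin (min_pos P) (min_pos Q).
Proof.
apply: min_posP; have := min_pos_spec P; have := min_pos_spec Q.
case: (min_pos P) => [p|]; case: (min_pos Q) => [q|] /=.
- move=> [q0 Qq minq] [p0 Pp minp]; split.
  + by case: (leqP p q).
  + by case: (leqP p q) => _; [left|right].
  + by move=> m m0 [/(minp m m0)|/(minq m m0)]; lia.
- move=> nQ [p0 Pp minp]; split=> //; first by left.
  by move=> m m0 [/(minp m m0)//|/(nQ m m0)].
- move=> [q0 Qq minq] nP; split=> //; first by right.
  by move=> m m0 [/(nP m m0)|/(minq m m0)//].
- by move=> nQ nP m m0 [/(nP m m0)|/(nQ m m0)].
Qed.

Lemma min_pos_map (f : nat -> nat) (P : nat -> Prop) :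
  {homo f : t u / t <= u} -> (forall t, 0 < t -> 0 < f t) ->
  min_pos (fun m => exists t, [/\ 0 < t, P t & m = f t]) = omap f (min_pos P).
Proof.
move=> fmono f0; apply: min_posP; have := min_pos_spec P.
case: (min_pos P) => [t [t0 Pt mint]|nP] /=.
  split; [exact: f0|by exists t|move=> _ _ [u [u0 Pu ->]]].
  exact/fmono/mint.
by move=> _ _ [t [t0 Pt _]]; exact: (nP t).
Qed.

(** After division by gcd(n, k), the other factor k / gcd(n, k) of t * k is
    coprime to n / gcd(n, k). *)
Lemma min_pos_dvd n k : 0 < n -> min_pos (fun t => n %| t * k) = Some (n %/ gcdn n k).
Proof.
move=> n0; have g0 : 0 < gcdn n k by rewrite gcdn_gt0 n0.
have dvdE t : (n %| t * k) = (n %/ gcdn n k %| t).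
  set g := gcdn n k in g0 *; have [nE kE] : n = n %/ g * g /\ k = k %/ g * g.
    by rewrite !divnK ?dvdn_gcdl ?dvdn_gcdr.
  rewrite [in LHS]nE [in LHS]kE mulnA dvdn_pmul2r // Gauss_dvdl //.
  by rewrite /coprime -(eqn_pmul2r g0) mul1n muln_gcdl -nE -kE.
apply: min_posP; split.
- by rewrite divn_gt0 // dvdn_leq // dvdn_gcdl.
- by rewrite dvdE.
- by move=> m m0; rewrite dvdE; exact: dvdn_leq.
Qed.

(** * Unions of two cyclic intervals *)

Section Circle.
Variables (n : nat) (hn : 1 < n).
Implicit Types (a u i : 'Z_n) (I J : {set 'Z_n}).
Local Open Scope ring_scope.

Lemma ltn_Zp i : (i < n)%N.
Proof. by rewrite -[X in (_ < X)%N](Zp_cast hn). Qed.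

Lemma val_natr s : (s < n)%N -> val (s%:R : 'Z_n) = s.
Proof. by move=> sn; rewrite /= val_Zp_nat // modn_small. Qed.

(** Used to name the peak before a in place of a itself: the vertices are then
    u + s with 0 <= s < n, and s = 0 is the peak. *)
Lemma exists_pred a : exists u, a = u + 1%:R.
Proof. by exists (a - 1); rewrite subrK. Qed.

Lemma posP u i : exists2 s, (s < n)%N & i = u + s%:R.
Proof. by exists (val (i - u)); rewrite ?ltn_Zp // natr_Zp addrC subrK. Qed.

Lemma val_shiftK u s : (s < n)%N -> val (u + s%:R - u) = s.
Proof. by move=> sn; rewrite addrC addKr val_natr. Qed.

Lemma val_shift_diff u s c : (s < n)%N -> (c <= n)%N ->
  val (u + s%:R - (u + c%:R)) = if (c <= s)%N then (s - c)%N else (s + n - c)%N.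
Proof.
move=> sn cn; have -> : u + s%:R - (u + c%:R) = s%:R - c%:R.
  by rewrite opprD addrACA subrr add0r.
case: ifP => cs; first by rewrite -natrB // val_natr //; lia.
have -> : s%:R - c%:R = (s + n - c)%:R :> 'Z_n.
  by rewrite natrB ?natrD ?(natr_n hn) ?addr0 //; lia.
by rewrite val_natr //; lia.
Qed.

Lemma eq_shift_natr u s c : (s < n)%N -> (c < n)%N ->
  (u + s%:R == u + c%:R) = (s == c).
Proof. by move=> sn cn; rewrite (inj_eq (addrI u)) -val_eqE !val_natr. Qed.

Lemma eq_shift_natr0 u s : (s < n)%N -> (u + s%:R == u) = (s == 0%N).
Proof. by move=> sn; rewrite -(eq_shift_natr u sn (ltnW hn)) addr0. Qed.

Lemma mem_cint a d i : (d <= n)%N -> (i \in cint a d) = (val (i - a)%R < d)%N.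
Proof.
move=> dn; apply/imsetP/idP => [[s _ ->]|id].
  by rewrite val_shiftK //; have := ltn_ord s; lia.
by exists (Ordinal id) => //; rewrite [RHS]addrC (natr_Zp (i - a)) subrK.
Qed.

(** The second disjunct accounts for an interval that passes the vertex u, where
    the coordinate s starts again from 0. It makes every question about the
    position of intervals on the circle a question of linear arithmetic. *)
Lemma mem_cint_shift u s c d : (s < n)%N -> (c <= n)%N -> (d <= n)%N ->
  (u + s%:R \in cint (u + c%:R) d) =
  (c <= s < c + d)%N || (s + n < c + d)%N.
Proof. by move=> sn cn dn; rewrite mem_cint // val_shift_diff //; case: ifP; lia. Qed.

Lemma card_cint a d : (d <= n)%N -> #|cint a d| = d.
Proof.
move=> dn; rewrite card_imset ?card_ord // => s t /addrI /(congr1 val).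
by rewrite !val_natr ?(leq_trans (ltn_ord _) dn) // => /val_inj.
Qed.

Section TwoIntervals.
Variables (I : {set 'Z_n}) (a : 'Z_n) (d1 l1 d2 l2 : nat).
Hypothesis hI : two_intervals I a d1 l1 d2 l2.

Lemma mem_two s : (s < n)%N ->
  (a - 1 + s%:R \in I) = (0 < s <= d1)%N || (d1 + l1 < s <= d1 + l1 + d2)%N.
Proof.
case: hI => h0 hs -> sn; rewrite inE; have [u ->] := exists_pred a.
by rewrite addrK -addrA -natrD !mem_cint_shift //; lia.
Qed.

Lemma card_two : #|I| = (d1 + d2)%N.
Proof.
case: hI => h0 hs ->; rewrite cardsU !card_cint; try lia.
suff -> : cint a d1 :&: cint (a + (d1 + l1)%:R) d2 = set0 by rewrite cards0 subn0.
apply/setP => i; rewrite !inE; have [s sn ->] := posP a i.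
have := @mem_cint_shift a s 0 d1 sn; rewrite addr0 => -> //; last lia.
by rewrite mem_cint_shift //; lia.
Qed.

(** The symmetry of the situation: what is shown for the first interval holds for
    the second one. *)
Lemma two_rot : two_intervals I (a + (d1 + l1)%:R) d2 l2 d1 l1.
Proof.
case: hI => h0 hs IE; split; [lia|lia|rewrite IE setUC; congr (_ :|: _)].
by rewrite -addrA -natrD (_ : (_ + _)%N = n) ?(natr_n hn) ?addr0 //; lia.
Qed.

(** The subset J with Omega(L_I) = L_J. *)
Definition syzset : {set 'Z_n} :=
  cint (a + d1%:R) d2 :|: cint (a + d1%:R + (d2 + l1)%:R) d1.

Lemma two_syz : two_intervals syzset (a + d1%:R) d2 l1 d1 l2.
Proof. by case: hI => h0 hs _; split=> //; lia. Qed.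

Lemma two_peaks : peaks I = [set a - 1; a + (d1 + l1)%:R - 1].
Proof.
case: (hI) => h0 hs _; apply/setP => i; rewrite !inE.
have mem := mem_two; have [u aE] := exists_pred a; rewrite aE addrK in mem *.
have -> : u + 1%:R + (d1 + l1)%:R - 1 = u + (d1 + l1)%:R by rewrite addrAC addrK.
have [s sn ->] := posP u i; rewrite mem //.
rewrite eq_shift_natr0 // eq_shift_natr //; last lia.
rewrite -addrA -[1]/(1%:R) -natrD; have [sn1|] := ltnP (s + 1) n.
  by rewrite mem //; lia.
move=> ns; have -> : (s + 1 = n)%N by lia.
by have := mem 0%N; rewrite (natr_n hn) mulr0n !addr0 => -> //; lia.
Qed.

Lemma peak_neq : a - 1 != a + (d1 + l1)%:R - 1.
Proof. by case: hI => h0 hs _; rewrite eq_sym addrAC eq_shift_natr0 //; lia. Qed.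

Lemma two_valleys : valleys I = [set a + d1%:R - 1; a + (d1 + l1 + d2)%:R - 1].
Proof.
case: (hI) => h0 hs _; apply/setP => i; rewrite !inE.
have mem := mem_two; have [u aE] := exists_pred a; rewrite aE addrK in mem *.
have E c : u + 1%:R + c%:R - 1 = u + c%:R by rewrite addrAC addrK.
rewrite !E; have [s sn ->] := posP u i; rewrite mem //.
rewrite !eq_shift_natr //; try lia.
rewrite -addrA -[1]/(1%:R) -natrD; have [sn1|] := ltnP (s + 1) n.
  by rewrite mem //; lia.
move=> ns; have -> : (s + 1 = n)%N by lia.
by have := mem 0%N; rewrite (natr_n hn) mulr0n !addr0 => -> //; lia.
Qed.

(** The path of s arrows x starting at the peak u = a - 1 is t^p times the
    generator of the target in P_u and t^q times the generator in L_I, where p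
    and q count the arrows that act by t, that is, those whose end lies outside
    the interval of P_u, or outside I. The cover P_u -> L_I therefore multiplies
    by t^(q - p) at u + s, and q - p is the number of elements of the interval of
    P_u among the first s vertices after u, minus that of elements of I. *)
Definition cover_exp_at s : nat :=
  (minn s (d1 + d2) - (minn s d1 + minn (s - (d1 + l1)) d2))%N.

End TwoIntervals.

Definition cover_exp a d1 l1 d2 i := cover_exp_at d1 l1 d2 (val (i - (a - 1))).

Section Exponents.
Variables (I : {set 'Z_n}) (a : 'Z_n) (d1 l1 d2 l2 : nat).
Hypothesis hI : two_intervals I a d1 l1 d2 l2.

(** Says that multiplication by t^(cover_exp i) at each vertex i commutes with the
    arrows, from the module of the interval starting at a to L_I. *)
Lemma cover_exp_step i :
  (cover_exp a d1 l1 d2 i + (i \notin cint a (d1 + d2)) =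
   cover_exp a d1 l1 d2 (i - 1)%R + (i \notin I))%N.
Proof.
case: (hI) => h0 hs _; have mem := mem_two hI; rewrite /cover_exp.
have [u aE] := exists_pred a; rewrite aE !addrK in mem *.
have [s sn ->] := posP u i; rewrite mem // mem_cint_shift //; try lia.
rewrite val_shiftK //; case: s sn => [|s] sn.
  have -> : u + 0%:R - 1 = u + (n - 1)%:R.
    by rewrite natrB ?(natr_n hn) ?addr0 ?sub0r //; lia.
  by rewrite val_shiftK /cover_exp_at; lia.
have -> : u + s.+1%:R - 1 = u + s%:R by rewrite -natr1 addrA addrK.
by rewrite val_shiftK /cover_exp_at; lia.
Qed.

(** The cover from the first peak is onto from the second valley through that peak
    to the first valley, and the cover from the second peak on the remaining arc.
    In particular the two projectives together cover L_I. *)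
Lemma cover_exp_disj i :
  cover_exp a d1 l1 d2 i = 0%N \/ cover_exp (a + (d1 + l1)%:R) d2 l2 d1 i = 0%N.
Proof.
case: (hI) => h0 hs _; have [s sn ->] := posP (a - 1) i.
rewrite /cover_exp val_shiftK // [a + _ - 1]addrAC val_shift_diff //; try lia.
by rewrite /cover_exp_at; case: ifP; lia.
Qed.

Lemma cover_exp0 s : (s <= d1)%N -> cover_exp a d1 l1 d2 (a - 1 + s%:R) = 0%N.
Proof.
by case: (hI) => h0 hs _ sd; rewrite /cover_exp val_shiftK /cover_exp_at; lia.
Qed.

Lemma cover_exp0_back r : (r <= l2)%N -> cover_exp a d1 l1 d2 (a - 1 - r%:R) = 0%N.
Proof.
case: (hI) => h0 hs _; case: r => [|r] rl.
  by rewrite subr0; have := cover_exp0 (leq0n d1); rewrite mulr0n addr0.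
have -> : a - 1 - r.+1%:R = a - 1 + (n - r.+1)%:R.
  by rewrite natrB ?(natr_n hn) ?sub0r //; lia.
by rewrite /cover_exp val_shiftK /cover_exp_at; lia.
Qed.

(** The inclusion-exclusion identity that determines the kernel of the projective
    cover; the two sides are indicator functions. *)
Lemma mem_syzset i :
  ((i \in syzset a d1 l1 d2) + (i \in I) =
   (i \in cint a (d1 + d2)) + (i \in cint (a + (d1 + l1)%:R)%R (d1 + d2)))%N.
Proof.
case: (hI) => h0 hs _; have [s sn ->] := posP (a - 1) i.
rewrite (mem_two hI) // inE; have [u ->] := exists_pred a.
rewrite addrK -!addrA -!natrD !mem_cint_shift //; lia.
Qed.

End Exponents.

(** A start of an interval is the successor of a peak, and there are two peaks.
    Once the start is known, the lengths are determined by the positions at which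
    membership in I changes. *)
Lemma two_eq a d1 l1 d2 l2 a' d1' l1' d2' l2' I :
  two_intervals I a d1 l1 d2 l2 -> two_intervals I a' d1' l1' d2' l2' ->
  [/\ a' = a, d1' = d1, l1' = l1 & d2' = d2] \/
  [/\ a' = a + (d1 + l1)%:R, d1' = d2, l1' = l2 & d2' = d1].
Proof.
have same b e1 m1 e2 m2 e1' m1' e2' m2' : two_intervals I b e1 m1 e2 m2 ->
    two_intervals I b e1' m1' e2' m2' -> [/\ e1' = e1, m1' = m1 & e2' = e2].
  move=> h h'; case: (h) => [h0 hs _]; case: (h') => h0' hs' _.
  have E s : (s < n)%N -> (0 < s <= e1)%N || (e1 + m1 < s <= e1 + m1 + e2)%N =
      (0 < s <= e1')%N || (e1' + m1' < s <= e1' + m1' + e2')%N.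
    by move=> sn; rewrite -(mem_two h sn) -(mem_two h' sn).
  have e1E : e1' = e1 by have := E e1.+1; have := E e1'.+1; lia.
  have m1E : m1' = m1 by have := E (e1 + m1).+1; have := E (e1 + m1').+1; lia.
  by split=> //; have := E (e1 + m1 + e2).+1; have := E (e1 + m1 + e2').+1; lia.
move=> h h'; have : a' - 1 \in peaks I by rewrite (two_peaks h') !inE eqxx.
rewrite (two_peaks h) !inE => /orP[] /eqP /addIr aE; [left|right].
  by rewrite aE in h' *; have [] := same _ _ _ _ _ _ _ _ _ h h'.
rewrite aE in h' *; have [] := same _ _ _ _ _ _ _ _ _ (two_rot h) h'.
by move=> -> ->.
Qed.

End Circle.

(** * Homomorphisms into and out of the modules L_I *)

Local Open Scope ring_scope.

Section Isomorphisms.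
Variables (F : fieldType) (n k : nat).
Implicit Types L M N : bmod F n k.

Lemma biso_sym M N : biso M N -> biso N M.
Proof.
move=> [f [fe fx fy] [g fK gK]].
pose h : {linear N -> M} :=
  HB.pack g (GRing.isLinear.Build _ _ _ _ g (can2_linear fK gK)).
by exists h; [split=> *; apply: (can_inj fK); rewrite ?(fe, fx, fy) !gK|exists f].
Qed.

Lemma biso_trans M N Q : biso M N -> biso N Q -> biso M Q.
Proof.
move=> [f [fe fx fy] fb] [g [ge gx gy] gb].
exists (g \o f : {linear M -> Q}); last exact: bij_comp.
by split=> *; rewrite !lcompE ?fe ?fx ?fy ?ge ?gx ?gy.
Qed.

(** Reduces an isomorphism with a kernel, which is a subtype, to exactness
    statements about elements. *)
Lemma biso_bker M N L (f : {linear M -> N}) (fB : bhom f) (h : {linear L -> M}) :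
  bhom h -> injective h -> (forall l, f (h l) = 0) ->
  (forall m, f m = 0 -> exists l, h l = m) -> biso (bker fB) L.
Proof.
move=> [he hx hy] h_inj fh0 hsurj; apply: biso_sym.
have hk l : h l \in in_ker f by rewrite inE fh0.
pose g l : bker fB := Kernel (hk l).
have gL : linear g by move=> c u v; apply: val_inj; rewrite /= linearP.
pose G : {linear L -> bker fB} := HB.pack g (GRing.isLinear.Build _ _ _ _ g gL).
exists G.
  by split=> *; apply: val_inj; rewrite /= ?he ?hx ?hy.
have pre (m : kernel f) : {l | h l = ker_val m}.
  apply: cid; apply: hsurj; by have := ker_valP m; rewrite inE => /eqP.
exists (fun m => sval (pre m)) => [l|m].
  by apply: h_inj; rewrite (svalP (pre _)).
by apply: val_inj; rewrite /= (svalP (pre _)).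
Qed.

End Isomorphisms.

Section PolynomialAction.
Variables (F : fieldType).

Section Action.
Variables (V : lmodType F) (T : {linear V -> V}).

(** The action of F[t] on a module, with T the action of t. *)
Definition poly_act (v : V) (p : {poly F}) : V := \sum_(c < size p) p`_c *: iter c T v.

Lemma poly_act_widen N v (p : {poly F}) : (size p <= N)%N ->
  poly_act v p = \sum_(c < N) p`_c *: iter c T v.
Proof.
move=> pN; rewrite /poly_act (big_ord_widen _ (fun c => p`_c *: iter c T v) pN).
rewrite big_mkcond; apply: eq_bigr => c _; case: ltnP => // pc.
by rewrite nth_default ?scale0r.
Qed.

Lemma poly_act_linear v : linear (poly_act v).
Proof.
move=> c p q; pose N := maxn (size (c *: p + q)) (maxn (size p) (size q)).
rewrite !(@poly_act_widen N) ?leq_max ?leqnn ?orbT // scaler_sumr -big_split.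
by apply: eq_bigr => i _; rewrite coefD coefZ scalerDl scalerA.
Qed.

Lemma poly_act0 v : poly_act v 0 = 0.
Proof. by rewrite /poly_act size_poly0 big_ord0. Qed.

Lemma poly_act0l p : poly_act 0 p = 0.
Proof.
rewrite /poly_act big1 // => c _; rewrite (_ : iter c T 0 = 0) ?scaler0 //.
by elim: (c : nat) => //= m ->; rewrite linear0.
Qed.

Lemma poly_act1 v : poly_act v 1 = v.
Proof. by rewrite /poly_act size_poly1 big_ord1 coefC eqxx scale1r. Qed.

Lemma poly_actX v p : poly_act v ('X * p) = poly_act (T v) p.
Proof.
have sz : (size ('X * p)%R <= (size p).+1)%N.
  by apply: leq_trans (size_polyMleq _ _) _; rewrite size_polyX.
rewrite (poly_act_widen _ sz) big_ord_recl coefXM eqxx scale0r add0r /poly_act.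
by apply: eq_bigr => c _; rewrite coefXM /= -iterS iterSr.
Qed.

End Action.

Lemma poly_act_morph (V W : lmodType F) (T : {linear V -> V}) (T' : {linear W -> W})
    (g : {linear V -> W}) v p :
  (forall u, g (T u) = T' (g u)) -> g (poly_act T v p) = poly_act T' (g v) p.
Proof.
move=> gT; rewrite linear_sum; apply: eq_bigr => c _; rewrite linearZ; congr (_ *: _).
by elim: (c : nat) => //= m <-; rewrite gT.
Qed.

End PolynomialAction.

Section Generators.
Variables (F : fieldType) (n k : nat) (hn : (1 < n)%N) (hk : (0 < k < n)%N).
Implicit Types (M N : bmod F n k) (I J K : ksubset n k) (i j u : 'Z_n).
Local Notation P := (proj_sort F n k).
Local Notation L := (L_module F hn hk).
Local Notation U := (L_unit F hn hk).

Definition from_proj M (m : M) : {linear P -> M} := pext (@act_rel F n k M m).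

Lemma from_projE M (m : M) w : from_proj m (pw F n k w) = act m w.
Proof. exact: pextE. Qed.

Lemma from_proj_pcons M (m : M) c a :
  from_proj m (pcons F n k c a) = (if c then vx M else vy M) (from_proj m a).
Proof.
apply: (@proj_ind F n k _ (from_proj m \o pcons F n k c)
  ((if c then vx M else vy M) \o from_proj m)) => w.
by rewrite !lcompE pconsE !from_projE; case: c.
Qed.

Lemma from_proj_uniq M (m : M) (f : {linear P -> M}) :
  (forall c a, f (pcons F n k c a) = (if c then vx M else vy M) (f a)) ->
  f (pw F n k [::]) = m -> f =1 from_proj m.
Proof.
move=> fc f1; apply: proj_ind => w; rewrite from_projE.
elim: w => //= c w IH.
by rewrite -pconsE fc IH; case: c.
Qed.

(** P_j itself; the direct sum [psum] over a singleton would make each of its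
    elements a function on that singleton. *)
Definition pmod j : bmod F n k :=
  BMod (@pe_orth F n k hn hk j) (@pe_sum F n k hn hk j)
    (@pcons_pe F n k hn hk true j) (@pcons_pe F n k hn hk false j)
    (@pcons_comm F n k) (@pcons_pow F n k).

Lemma from_proj_bhom j M (m : M) : ve M j m = m -> bhom (M := pmod j) (from_proj m).
Proof.
move=> mj; split=> [i||] a; last first.
- exact: from_proj_pcons.
- exact: from_proj_pcons.
apply: (@proj_ind F n k _ (from_proj m \o pe F hn hk j i) (ve M i \o from_proj m)) => w.
by rewrite !lcompE peE !from_projE (ve_act _ _ mj); case: eqP;
  rewrite ?from_projE ?linear0.
Qed.

(** L_K is generated by its units U_i, subject to the relations that express the
    arrows between neighbouring units; elements g i satisfying these relations
    define a homomorphism. *)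
Section FromL.
Variables (K : ksubset n k) (M : bmod F n k) (g : 'Z_n -> M).
Local Notation T := (vx M \o vy M : {linear M -> M}).

Definition from_L_fun (f : L K) : M :=
  \sum_i poly_act T (g i) ((f : {ffun 'Z_n -> {poly F}}) i).

Lemma from_L_linear : linear from_L_fun.
Proof.
move=> c f h; rewrite /from_L_fun scaler_sumr -big_split /=.
by apply: eq_bigr => i _; rewrite !ffunE poly_act_linear.
Qed.

Definition from_L : {linear L K -> M} :=
  HB.pack from_L_fun (GRing.isLinear.Build _ _ _ _ from_L_fun from_L_linear).

Lemma from_LE f : from_L f = \sum_i poly_act T (g i) ((f : {ffun 'Z_n -> {poly F}}) i).
Proof. by []. Qed.

Lemma from_LU i : from_L (U K i) = g i.
Proof.
rewrite from_LE (bigD1 i) //= ffunE eqxx poly_act1 big1 ?addr0 // => j.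
by rewrite ffunE => /negPf ->; rewrite poly_act0.
Qed.

Hypothesis ge : forall i, ve M i (g i) = g i.
Hypothesis gx : forall i, vx M (g (i - 1)) = if i \in val K then g i else T (g i).
Hypothesis gy : forall i, vy M (g i) = if i \in val K then T (g (i - 1)) else g (i - 1).

Lemma Tx m : vx M (T m) = T (vx M m).
Proof. by rewrite !lcompE vxyC. Qed.

Lemma Ty m : vy M (T m) = T (vy M m).
Proof. by rewrite !lcompE -vxyC. Qed.

Lemma Te i m : ve M i (T m) = T (ve M i m).
Proof. by rewrite !lcompE vy_ve vx_ve subrK. Qed.

Lemma from_L_bhom : bhom from_L.
Proof.
split=> [j||] f; rewrite !from_LE linear_sum.
- apply: eq_bigr => i _; rewrite (poly_act_morph _ _ (Te j)) ffunE -(ge i) ve_orth.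
  by rewrite [i == j]eq_sym; case: eqP => [//|_]; rewrite poly_act0 poly_act0l.
- rewrite [RHS](reindex_inj (addIr (-1))) /=; apply: eq_bigr => i _.
  rewrite (poly_act_morph _ _ Tx) gx ffunE /xcoef.
  by case: ifP; rewrite ?mul1r ?poly_actX.
- rewrite [RHS](reindex_inj (addIr 1)) /=; apply: eq_bigr => i _.
  rewrite (poly_act_morph _ _ Ty) gy ffunE /ycoef addrK.
  by case: ifP; rewrite ?mul1r ?poly_actX.
Qed.

End FromL.

Lemma L_T K (f : L K) : (vx (L K) \o vy (L K)) f =
  [ffun i => 'X * (f : {ffun 'Z_n -> {poly F}}) i].
Proof.
apply/ffunP => i; rewrite !ffunE subrK mulrA /xcoef /ycoef.
by case: ifP; rewrite ?mul1r ?mulr1.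
Qed.

Lemma iter_L_T K c i : iter c (vx (L K) \o vy (L K)) (U K i) =
  [ffun j => if j == i then 'X^c else 0].
Proof.
elim: c => [|c IH]; first by apply/ffunP => j; rewrite !ffunE.
rewrite iterS IH L_T; apply/ffunP => j; rewrite !ffunE.
by case: eqP; rewrite ?mulr0 // exprS.
Qed.

Lemma L_expand K (f : L K) : f = from_L K (U K) f.
Proof.
rewrite from_LE; apply/ffunP => i; rewrite sum_ffunE (bigD1 i) //= big1 ?addr0.
  rewrite /poly_act sum_ffunE -[LHS]coefK poly_def; apply: eq_bigr => c _.
  by rewrite iter_L_T !ffunE eqxx.
move=> j ji; rewrite /poly_act sum_ffunE big1 // => c _; rewrite iter_L_T !ffunE.
by rewrite eq_sym (negPf ji) scaler0.
Qed.

(** The units generate L_K over F[t], and t acts through x and y. *)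
Lemma L_uniq K M (f h : {linear L K -> M}) :
  bhom f -> bhom h -> (forall i, f (U K i) = h (U K i)) -> f =1 h.
Proof.
move=> [_ fx fy] [_ hx hy] fh m; rewrite (L_expand m) !from_LE !linear_sum.
apply: eq_bigr => i _.
have xy_morph (g : {linear L K -> M}) : (forall m, g (vx _ m) = vx _ (g m)) ->
    (forall m, g (vy _ m) = vy _ (g m)) ->
    forall m, g ((vx _ \o vy _) m) = (vx _ \o vy _) (g m).
  by move=> gx gy m'; rewrite /= gx gy.
by rewrite (poly_act_morph _ _ (xy_morph f fx fy))
  (poly_act_morph _ _ (xy_morph h hx hy)) fh.
Qed.

Lemma vx_unit K i : i \in val K -> vx (L K) (U K (i - 1)) = U K i.
Proof.
move=> iK; apply/ffunP => j; rewrite !ffunE (inj_eq (addIr (-1))) /xcoef.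
by case: (eqVneq j i) => [->|_]; rewrite ?iK ?mul1r ?mulr0.
Qed.

Lemma vy_unit K i : i \notin val K -> vy (L K) (U K i) = U K (i - 1).
Proof.
move=> iK; apply/ffunP => j; rewrite !ffunE eq_sym -subr_eq eq_sym /ycoef.
case: (eqVneq j (i - 1)) => [->|_]; rewrite ?subrK ?mulr0 //.
by rewrite (negPf iK) mul1r.
Qed.

Lemma ve_unit K i : ve (L K) i (U K i) = U K i.
Proof. by apply/ffunP => j; rewrite !ffunE; case: eqP. Qed.

(** The element i lies in I exactly if the arrow x ending at i is onto at i, as
    opposed to having its image inside the multiples of t. This does not change
    under isomorphism. *)
Lemma L_iso_inj I J : biso (L I) (L J) -> I = J.
Proof.
have surj K i : reflect (forall m, exists m', vx (L K) m' = ve (L K) i m) (i \in val K).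
  apply: (iffP idP) => [iK m|].
    exists [ffun j => if j == i - 1 then (m : {ffun 'Z_n -> {poly F}}) i else 0].
    apply/ffunP => j; rewrite !ffunE (inj_eq (addIr (-1))) /xcoef.
    by case: (eqVneq j i) => [->|_]; rewrite ?iK ?mul1r ?mulr0.
  move=> /(_ (U K i)) [m]; rewrite ve_unit => /ffunP /(_ i); rewrite !ffunE eqxx /xcoef.
  case: ifP => // _ /(congr1 (fun p : {poly F} => p`_0)).
  by rewrite coefXM coefC /= => /eqP; rewrite eq_sym oner_eq0.
have sub K K' : biso (L K) (L K') -> {subset val K <= val K'}.
  move=> [f [fe fx _] [g fK gK]] i /surj h; apply/surj => m.
  have [m' E] := h (g m); exists (f m').
  by rewrite -fx E fe gK.
move=> IJ; apply/val_inj/setP => i.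
by apply/idP/idP; [exact: (sub I J)|exact: (sub J I (biso_sym IJ))].
Qed.

End Generators.

(** * The indecomposable projectives have rank one *)

Section Projective.
Variables (F : fieldType) (n k : nat) (hn : (1 < n)%N) (hk : (0 < k < n)%N).
Implicit Types (M N : bmod F n k) (I J K : ksubset n k) (i j u : 'Z_n).
Local Notation P := (proj_sort F n k).
Local Notation L := (L_module F hn hk).
Local Notation U := (L_unit F hn hk).
Local Notation pw := (pw F n k).
Local Notation pmod := (pmod F hn hk).
Local Notation X := true.
Local Notation Y := false.

Lemma card_pset j : #|cint (j + 1) k| == k.
Proof. by rewrite card_cint //; case/andP: hk => _ /ltnW. Qed.

Definition pset j : ksubset n k := exist _ (cint (j + 1) k) (card_pset j).

(** The range 0 < s <= n, and not 0 <= s < n, makes s - 1 the coordinate of the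
    preceding vertex without wrapping around. *)
Lemma mem_pset j s : (0 < s <= n)%N -> (j + s%:R \in val (pset j)) = (s <= k)%N.
Proof.
move=> /andP[s0 sn]; rewrite /= -[1]/(1%:R).
have [sn'|ns] := ltnP s n; first by rewrite mem_cint_shift //; lia.
have -> : s = n by lia.
by rewrite (natr_n hn) -[0]/(0%:R) mem_cint_shift //; lia.
Qed.

(** The path of P_j that generates the component at j + s over F[t]: x^s up to
    s = k, where it equals y^(n-k), and then y^(n-s). For s = n this is the empty
    path again, as for s = 0. *)
Definition pgen_word s := if (s <= k)%N then nseq s X else nseq (n - s) Y.
Definition pgen j i : P := pw (pgen_word (val (i - j))).

Lemma pgen_wordY s : (k <= s <= n)%N -> pw (pgen_word s) = pw (nseq (n - s) Y).
Proof.
move=> /andP[ks sn]; rewrite /pgen_word; case: leqP => // sk.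
have -> : s = k by lia.
by apply: pw_rel; have := Rel_pow n k [::] [::]; rewrite /= !cats0.
Qed.

Lemma pgenE j s : (s <= n)%N -> pgen j (j + s%:R) = pw (pgen_word s).
Proof.
rewrite leq_eqVlt => /orP[/eqP ->|sn]; last by rewrite /pgen val_shiftK.
rewrite (natr_n hn) addr0 /pgen subrr.
by rewrite [RHS]pgen_wordY ?subnn //; case/andP: hk => _ /ltnW ->; rewrite leqnn.
Qed.

Lemma pw_comm w : pw (Y :: X :: w) = pw (X :: Y :: w).
Proof. by apply/esym/pw_rel; exact: (Rel_comm n k [::] w). Qed.

Lemma vx_pw j w : vx (pmod j) (pw w) = pw (X :: w).
Proof. exact: pconsE. Qed.

Lemma vy_pw j w : vy (pmod j) (pw w) = pw (Y :: w).
Proof. exact: pconsE. Qed.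

Lemma succ_posP j i : exists s, [/\ (s < n)%N, i = j + s.+1%:R & i - 1 = j + s%:R].
Proof.
have [s sn E] := posP hn j (i - 1); exists s; split=> //.
by rewrite -natr1 addrA -E subrK.
Qed.

Lemma endpt_pgen_word j s : (s <= n)%N -> endpt n j (pgen_word s) = j + s%:R.
Proof.
move=> sn; rewrite /pgen_word; case: ifP => _.
  by rewrite -[nseq _ _]cats0 endpt_X.
by rewrite -[nseq _ _]cats0 endpt_Y natrB // (natr_n hn) sub0r opprK.
Qed.

Lemma ve_pgen j i : ve (pmod j) i (pgen j i) = pgen j i.
Proof.
have [s [sn -> _]] := succ_posP j i; rewrite pgenE // [LHS]peE.
by rewrite endpt_pgen_word // eqxx.
Qed.

(** While s < k, another x lengthens the generator x^s. From s = k on it cancels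
    against a y of the generator y^(n-s) and leaves a factor t = xy. *)
Lemma vx_pgen j i : vx (pmod j) (pgen j (i - 1)) =
  if i \in val (pset j) then pgen j i
  else (vx (pmod j) \o vy (pmod j)) (pgen j i).
Proof.
have [s [sn iE ->]] := succ_posP j i; rewrite iE mem_pset //.
rewrite !pgenE ?(ltnW sn) //; case: ifP => sk.
  by rewrite vx_pw; congr pw; rewrite /pgen_word (ltnW sk) sk.
have ks : (k <= s)%N by lia.
rewrite (@pgen_wordY s) ?ks ?(ltnW sn) // ?lcompE !(vx_pw, vy_pw).
by congr pw; rewrite /pgen_word sk (_ : n - s = (n - s.+1).+1)%N //; lia.
Qed.

Lemma vy_pgen j i : vy (pmod j) (pgen j i) =
  if i \in val (pset j) then (vx (pmod j) \o vy (pmod j)) (pgen j (i - 1))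
  else pgen j (i - 1).
Proof.
have [s [sn iE ->]] := succ_posP j i; rewrite iE mem_pset //.
rewrite !pgenE ?(ltnW sn) //; case: ifP => sk.
  by rewrite lcompE !(vx_pw, vy_pw) -pw_comm; congr pw; rewrite /pgen_word (ltnW sk) sk.
have ks : (k <= s)%N by lia.
rewrite (@pgen_wordY s) ?ks ?(ltnW sn) // ?lcompE !(vx_pw, vy_pw).
by congr pw; rewrite /pgen_word sk (_ : n - s = (n - s.+1).+1)%N //; lia.
Qed.

Definition p_to_l j : {linear P -> L (pset j)} := from_proj (U (pset j) j).
Definition l_to_p j : {linear L (pset j) -> P} :=
  @from_L F n k hn hk (pset j) (pmod j) (pgen j).

Lemma p_to_l_bhom j : bhom (M := pmod j) (p_to_l j).
Proof. exact: from_proj_bhom (ve_unit _ _ _ _ _). Qed.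

Lemma l_to_p_bhom j : bhom (N := pmod j) (l_to_p j).
Proof. by apply: from_L_bhom; [exact: ve_pgen|exact: vx_pgen|exact: vy_pgen]. Qed.

Lemma p_to_l_X j s : (s <= k)%N -> p_to_l j (pw (nseq s X)) = U (pset j) (j + s%:R).
Proof.
rewrite from_projE; elim: s => [|s IH] sk; first by rewrite addr0.
have -> : act (U (pset j) j) (nseq s.+1 X) = vx _ (act (U (pset j) j) (nseq s X)) by [].
rewrite IH ?(ltnW sk) // -natr1 addrA -[in LHS](addrK 1 (j + s%:R)).
rewrite vx_unit // -addrA natr1 mem_pset //; have := andP hk; lia.
Qed.

Lemma p_to_l_Y j r : (r <= n - k)%N -> p_to_l j (pw (nseq r Y)) = U (pset j) (j - r%:R).
Proof.
rewrite from_projE; elim: r => [|r IH] rk; first by rewrite subr0.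
have -> : act (U (pset j) j) (nseq r.+1 Y) = vy _ (act (U (pset j) j) (nseq r Y)) by [].
rewrite IH ?(ltnW rk) // vy_unit.
  by rewrite -addrA -opprD natr1.
have -> : j - r%:R = j + (n - r)%:R by rewrite natrB ?(natr_n hn) ?sub0r //; lia.
by rewrite mem_pset; have := andP hk; lia.
Qed.

Lemma l_to_pU j i : l_to_p j (U (pset j) i) = pgen j i.
Proof. exact: (@from_LU F n k hn hk (pset j) (pmod j) (pgen j) i). Qed.

(** An endomorphism of P_j is determined by the image of e_j. *)
Lemma p_to_lK j : cancel (p_to_l j) (l_to_p j).
Proof.
move=> a; have [_ px py] := p_to_l_bhom j; have [_ lx ly] := l_to_p_bhom j.
have e0 : pgen j j = pw [::] by have := @pgenE j 0 isT; rewrite addr0.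
have uE M (f : {linear P -> pmod j}) : f (pw [::]) = pw [::] ->
  (forall a, f (pcons F n k X a) = pcons F n k X (f a)) ->
  (forall a, f (pcons F n k Y a) = pcons F n k Y (f a)) ->
  f =1 from_proj (M := pmod j) (pw [::]).
  by move=> f0 fX fY; apply: from_proj_uniq => // -[] b; rewrite ?fX ?fY.
rewrite -[LHS]/((l_to_p j \o p_to_l j) a) (@uE (pmod j)) //.
- by rewrite -(@uE (pmod j) idfun).
- by rewrite lcompE from_projE -[act _ _]/(U (pset j) j) l_to_pU e0.
- by move=> b; rewrite !lcompE (px b) lx.
- by move=> b; rewrite !lcompE (py b) ly.
Qed.

(** An endomorphism of a rank one module is determined by the images of the units. *)
Lemma l_to_pK j : cancel (l_to_p j) (p_to_l j).
Proof.
move=> f; have [pe px py] := p_to_l_bhom j; have [le lx ly] := l_to_p_bhom j.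
apply: (@L_uniq F n k hn hk (pset j) (L (pset j)) (p_to_l j \o l_to_p j) idfun) => //.
  by split=> *; rewrite !lcompE ?le ?lx ?ly ?pe ?px ?py.
move=> i; rewrite lcompE l_to_pU; have [s [sn -> _]] := succ_posP j i.
rewrite pgenE // /pgen_word; case: ifP => sk; first exact: p_to_l_X.
rewrite p_to_l_Y; last lia.
by rewrite natrB // (natr_n hn) sub0r opprK.
Qed.

End Projective.

(** * Kernels of maps from two projectives onto a rank one module *)

Section Monomial.
Variables (F : fieldType) (n : nat).
Local Notation V := {ffun 'Z_n -> {poly F}}.

Section Exponent.
Variable e : 'Z_n -> nat.
(** Up to scalars, all homomorphisms between rank one modules that are needed below
    have this form. *)
Definition xpow_map_fun (f : V) : V := [ffun i => 'X^(e i) * f i].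

Lemma xpow_map_linear : linear xpow_map_fun.
Proof. by move=> c f g; apply/ffunP => i; rewrite !ffunE mulrDr scalerAr. Qed.

Definition xpow_map : {linear V -> V} :=
  HB.pack xpow_map_fun (GRing.isLinear.Build _ _ _ _ xpow_map_fun xpow_map_linear).

Lemma xpow_mapE f i : xpow_map f i = 'X^(e i) * f i.
Proof. by rewrite /xpow_map /= ffunE. Qed.

Lemma xpow_map_inj : injective xpow_map.
Proof.
move=> f g /ffunP fg; apply/ffunP => i; have := fg i; rewrite !xpow_mapE.
by apply: mulfI; rewrite expf_neq0 // polyX_eq0.
Qed.

End Exponent.

Variables (k : nat) (hn : (1 < n)%N) (hk : (0 < k < n)%N).
Implicit Types (I J K : ksubset n k).
Local Notation L := (L_module F hn hk).

(** The hypothesis compares the powers of t along the two paths of the square formed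
    by the arrow x into i and the map. The squares of the arrows y give the same
    condition, since y acts by t where x acts by 1 and conversely. *)
Lemma xpow_map_bhom K K' (e : 'Z_n -> nat) :
  (forall i, e i + (i \notin val K) = e (i - 1)%R + (i \notin val K'))%N ->
  bhom (M := L K) (N := L K') (xpow_map e).
Proof.
move=> eE; have XE b : (if b then 1 else 'X) = 'X^(~~ b) :> {poly F} by case: b.
have XE' b : (if b then 'X else 1) = 'X^b :> {poly F} by case: b.
split=> [i||] f; apply/ffunP => j; rewrite xpow_mapE !ffunE ?xpow_mapE.
- by case: eqP; rewrite ?mulr0 ?xpow_mapE.
- by rewrite /xcoef !XE !mulrA -!exprD eE addnC.
(* the arrow y from j + 1 to j is opposite to the arrow x ending at j + 1 *)
- rewrite /ycoef !XE' !mulrA -!exprD; congr ('X^_ * _).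
  have step (b b' : bool) (x y : nat) :
      (x + ~~ b = y + ~~ b' -> y + b = b' + x)%N by lia.
  by apply: step; have := eE ((j : 'Z_n) + 1); rewrite addrK.
Qed.

Lemma xpow_map_unit K K' (e : 'Z_n -> nat) i : e i = 0%N ->
  xpow_map e (L_unit F hn hk K i) = L_unit F hn hk K' i.
Proof.
move=> e0; apply/ffunP => j; rewrite xpow_mapE !ffunE.
by case: eqP => [->|_]; rewrite ?e0 ?mulr0 ?mulr1.
Qed.

End Monomial.

(** [weighted_cover] is the projective cover of L_I with the generators scaled by
    c. Its kernel is the image of L_J under [syz_incl], which is injective. *)
Section TwoGenerators.
Variables (F : fieldType) (n k : nat) (hn : (1 < n)%N) (hk : (0 < k < n)%N).
Local Notation P := (proj_sort F n k).
Local Notation L := (L_module F hn hk).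
Local Notation xpow_map := (xpow_map F).
Local Notation U := (L_unit F hn hk).

Variables (I J : ksubset n k) (a : 'Z_n) (d1 l1 d2 l2 : nat).
Hypothesis hI : two_intervals (val I) a d1 l1 d2 l2.
Hypothesis hJ : val J = syzset a d1 l1 d2.

Local Notation u1 := (a - 1).
Local Notation u2 := (a + (d1 + l1)%:R - 1).
Local Notation e1 := (cover_exp a d1 l1 d2).
Local Notation e2 := (cover_exp (a + (d1 + l1)%:R) d2 l2 d1).

Lemma k_sum : k = (d1 + d2)%N.
Proof. by rewrite -(eqP (valP I)) (card_two hn hI). Qed.

Lemma k_sum' : k = (d2 + d1)%N.
Proof. by rewrite k_sum addnC. Qed.

Lemma e1_cover i : (e1 i + (i \notin val (pset hn hk u1)) =
                    e1 (i - 1)%R + (i \notin val I))%N.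
Proof. by have := cover_exp_step hn hI i; rewrite -k_sum /= subrK. Qed.

Lemma e2_cover i : (e2 i + (i \notin val (pset hn hk u2)) =
                    e2 (i - 1)%R + (i \notin val I))%N.
Proof. by have := cover_exp_step hn (two_rot hn hI) i; rewrite -k_sum' /= subrK. Qed.

Lemma mem_J i : ((i \in val J) + (i \in val I) =
  (i \in val (pset hn hk u1)) + (i \in val (pset hn hk u2)))%N.
Proof. by have := mem_syzset hn hI i; rewrite -hJ -k_sum /= !subrK. Qed.

(** The exponent of the cover from one peak is also the exponent of the inclusion of
    the kernel into the projective of the other peak: by [mem_syzset] the two
    conditions are equivalent. *)
Lemma e2_incl i : (e2 i + (i \notin val J) =
                   e2 (i - 1)%R + (i \notin val (pset hn hk u1)))%N.
Proof. by have := e2_cover i; have := mem_J i; do 4!case: (i \in _) => /=; lia. Qed.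

Lemma e1_incl i : (e1 i + (i \notin val J) =
                   e1 (i - 1)%R + (i \notin val (pset hn hk u2)))%N.
Proof. by have := e1_cover i; have := mem_J i; do 4!case: (i \in _) => /=; lia. Qed.

Lemma e1_u1 : e1 u1 = 0%N.
Proof. by have := cover_exp0 hn hI (leq0n d1); rewrite addr0. Qed.

Lemma e2_u2 : e2 u2 = 0%N.
Proof. by have := cover_exp0 hn (two_rot hn hI) (leq0n d2); rewrite addr0. Qed.

Variables (S : {set 'Z_n}) (c : 'Z_n -> F).
Hypotheses (hS : S = [set u1; u2]) (c1 : c u1 != 0) (c2 : c u2 != 0).

Local Notation PS := (psum F hn hk S).
Local Notation T := {j | j \in S}.

Definition weighted_cover : {linear PS -> L I} :=
  psum_hom hn hk S (M := L I) (fun j => c j *: U I j).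

Lemma peak1_subproof : u1 \in S. Proof. by rewrite hS set21. Qed.
Lemma peak2_subproof : u2 \in S. Proof. by rewrite hS set22. Qed.
Definition peak1 : T := exist _ u1 peak1_subproof.
Definition peak2 : T := exist _ u2 peak2_subproof.

Lemma peak_cases (s : T) : s = peak1 \/ s = peak2.
Proof.
have : val s \in [set u1; u2] by rewrite -hS; exact: (valP s).
rewrite !inE.
by case/orP => /eqP E; [left|right]; apply: val_inj.
Qed.

Lemma sum_peaks (V : zmodType) (f : T -> V) : \sum_s f s = f peak1 + f peak2.
Proof.
have s21 : peak2 != peak1 by rewrite -val_eqE /= eq_sym (peak_neq hn hI).
rewrite (bigD1 peak1) //= (bigD1 peak2) //= big1 ?addr0 // => s.
by case: (peak_cases s) => ->; rewrite eqxx ?andbF.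
Qed.

(** Both sides are homomorphisms from P_u that agree on e_u. *)
Lemma from_proj_unit (u : 'Z_n) (e : 'Z_n -> nat) a0 : e u = 0%N ->
  (forall i, e i + (i \notin val (pset hn hk u)) =
             e (i - 1)%R + (i \notin val I))%N ->
  from_proj (c u *: U I u) a0 = c u *: (xpow_map e (p_to_l F hn hk u a0) : L I).
Proof.
move=> eu /(xpow_map_bhom F hn hk) [_ mx my]; have [_ px py] := p_to_l_bhom F hn hk u.
apply/esym.
pose h : {linear P -> L I} :=
  c u \*: ((xpow_map e : {linear L (pset hn hk u) -> L I}) \o p_to_l F hn hk u).
apply: (from_proj_uniq (f := h)); last first.
  rewrite -[LHS]/(c u *: (xpow_map e (p_to_l F hn hk u _) : L I)) from_projE.
  by congr (_ *: _); exact: xpow_map_unit.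
have hE b : h b = c u *: (xpow_map e (p_to_l F hn hk u b) : L I) by [].
case=> b; rewrite !hE.
  by rewrite (px b) mx linearZ.
by rewrite (py b) my linearZ.
Qed.

Local Notation Phi := (p_to_l F hn hk).
Local Notation Psi := (l_to_p F hn hk).

Lemma weighted_coverE (f : PS) : weighted_cover f =
  c u1 *: (xpow_map e1 (Phi u1 ((f : {ffun T -> P}) peak1)) : L I) +
  c u2 *: (xpow_map e2 (Phi u2 ((f : {ffun T -> P}) peak2)) : L I).
Proof.
rewrite /weighted_cover psum_homE sum_peaks.
by congr (_ + _); [exact: from_proj_unit e1_u1 e1_cover|
  exact: from_proj_unit e2_u2 e2_cover].
Qed.

Definition syz_incl_fun (h : L J) : PS :=
  [ffun s : T => if s == peak1 then c u2 *: Psi u1 (xpow_map e2 h)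
                 else - c u1 *: Psi u2 (xpow_map e1 h)].

Lemma syz_incl_linear : linear syz_incl_fun.
Proof.
move=> b f g; apply/ffunP => s; rewrite !ffunE.
case: ifP => _.
  by rewrite (linearP (xpow_map e2)) (linearP (Psi u1)) scalerDr !scalerA mulrC.
by rewrite (linearP (xpow_map e1)) (linearP (Psi u2)) scalerDr !scalerA mulrC.
Qed.

Definition syz_incl : {linear L J -> PS} :=
  HB.pack syz_incl_fun (GRing.isLinear.Build _ _ _ _ syz_incl_fun syz_incl_linear).

Lemma syz_incl1 h : (syz_incl h : {ffun T -> P}) peak1 = c u2 *: Psi u1 (xpow_map e2 h).
Proof. by rewrite [LHS]ffunE eqxx. Qed.

Lemma syz_incl2 h :
  (syz_incl h : {ffun T -> P}) peak2 = - c u1 *: Psi u2 (xpow_map e1 h).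
Proof. by rewrite [LHS]ffunE -val_eqE /= eq_sym (negPf (peak_neq hn hI)). Qed.

Lemma syz_incl_bhom : bhom syz_incl.
Proof.
have [me mx my] := xpow_map_bhom F hn hk e2_incl.
have [me' mx' my'] := xpow_map_bhom F hn hk e1_incl.
have [pe px py] := l_to_p_bhom F hn hk u1.
have [pe' px' py'] := l_to_p_bhom F hn hk u2.
split=> [i||] f; apply/ffunP => s; rewrite ffmapE;
  have [->|->] := peak_cases s; rewrite ?syz_incl1 ?syz_incl2 linearZ; congr (_ *: _).
- by rewrite me pe.
- by rewrite me' pe'.
- by rewrite mx px.
- by rewrite mx' px'.
- by rewrite my py.
- by rewrite my' py'.
Qed.

Lemma syz_incl_inj : injective syz_incl.
Proof.
move=> f g /(congr1 (fun p : PS => (p : {ffun T -> P}) peak1)); rewrite !syz_incl1.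
by move=> /(scalerI c2) /(can_inj (@l_to_pK F n k hn hk u1)) /xpow_map_inj.
Qed.

Lemma weighted_cover_syz_incl h : weighted_cover (syz_incl h) = 0.
Proof.
have E1 : Phi u1 ((syz_incl h : {ffun T -> P}) peak1) = c u2 *: xpow_map e2 h.
  by rewrite syz_incl1 linearZ; congr (_ *: _); exact: l_to_pK.
have E2 : Phi u2 ((syz_incl h : {ffun T -> P}) peak2) = - c u1 *: xpow_map e1 h.
  by rewrite syz_incl2 linearZ; congr (_ *: _); exact: l_to_pK.
rewrite weighted_coverE E1 E2; apply/ffunP => i; rewrite !ffunE -!scalerAr !scalerA.
by rewrite mulrCA mulrN [c u2 * _]mulrC scaleNr subrr.
Qed.

(** At each vertex one of the exponents is 0, say that of the cover from the second
    peak; the equation then expresses the second coordinate of an element of the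
    kernel through the first one. *)
Lemma weighted_cover_exact (f : PS) : weighted_cover f = 0 -> exists h, syz_incl h = f.
Proof.
rewrite weighted_coverE => /ffunP f0.
pose q1 : {ffun 'Z_n -> {poly F}} := Phi u1 ((f : {ffun T -> P}) peak1).
pose q2 : {ffun 'Z_n -> {poly F}} := Phi u2 ((f : {ffun T -> P}) peak2).
have {}f0 i : c u1 *: ('X^(e1 i) * q1 i) = - (c u2 *: ('X^(e2 i) * q2 i)).
  by apply/eqP; rewrite -addr_eq0; apply/eqP; have := f0 i; rewrite !ffunE.
(* at each vertex, h is read off from the coordinate whose exponent is 0 *)
pose h : L J := [ffun i => if e2 i == 0%N then (c u2)^-1 *: q1 i
                           else - (c u1)^-1 *: q2 i].
exists h; apply/ffunP => s; have [->|->] := peak_cases s.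
- rewrite syz_incl1 -linearZ -[RHS](@p_to_lK F n k hn hk u1); congr (Psi _ _).
  apply/ffunP => i; rewrite !ffunE -/q1.
  case: (eqVneq (e2 i) 0%N) => [->|e2i].
    by rewrite mul1r scalerA divff // scale1r.
  have e1i : e1 i = 0%N by case: (cover_exp_disj hn hI i) e2i => [//|->].
  have := f0 i; rewrite e1i mul1r => E; rewrite -scalerAr scalerA mulrN scaleNr.
  by rewrite mulrC -scalerA -scalerN -E scalerA mulVf // scale1r.
- rewrite syz_incl2 -linearZ -[RHS](@p_to_lK F n k hn hk u2); congr (Psi _ _).
  apply/ffunP => i; rewrite !ffunE -/q2.
  case: (eqVneq (e2 i) 0%N) => [e2i|e2i].
    have := f0 i; rewrite e2i mul1r => E; rewrite -scalerAr scalerA mulNr scaleNr.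
    by rewrite mulrC -scalerA E scalerN opprK scalerA mulVf // scale1r.
  have e1i : e1 i = 0%N by case: (cover_exp_disj hn hI i) e2i => [//|->].
  by rewrite e1i mul1r scalerA mulrNN divff // scale1r.
Qed.

End TwoGenerators.

(** * The first two syzygies *)

Lemma find_iota (p : pred nat) m n :
  (m < n)%N -> p m -> (forall s, (s < m)%N -> ~~ p s) -> find p (iota 0 n) = m.
Proof.
move=> mn pm pN; have hasp : has p (iota 0 n).
  by apply/hasP; exists m => //; rewrite mem_iota.
have fn : (find p (iota 0 n) < n)%N by rewrite -{2}(size_iota 0 n) -has_find.
apply/eqP; rewrite eqn_leq; apply/andP; split; last first.
  rewrite leqNgt; apply/negP => /pN /negP; apply.
  by have := nth_find 0%N hasp; rewrite nth_iota.
rewrite leqNgt; apply/negP => mf.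
by have := before_find 0%N mf; rewrite nth_iota ?add0n ?pm.
Qed.

Section Distances.
Variables (n : nat) (hn : (1 < n)%N).
Variables (I : {set 'Z_n}) (a : 'Z_n) (d1 l1 d2 l2 : nat).
Hypothesis hI : two_intervals I a d1 l1 d2 l2.

(** Going back from the last element of the first interval, the first peak met is
    the vertex before that interval. *)
Lemma back_two : back I (a + d1%:R - 1) = d1.
Proof.
case: (hI) => h0 hs _; rewrite /back (two_peaks hn hI).
have E s : (s <= d1)%N -> a + d1%:R - 1 - s%:R = a - 1 + (d1 - s)%:R.
  by move=> sd; rewrite natrB // addrA [a - 1 + _]addrAC.
apply: find_iota; first by lia.
  by rewrite E // subnn addr0 set21.
by move=> s sd; rewrite E ?(ltnW sd) // [a + _ - 1]addrAC !inE
  eq_shift_natr0 ?eq_shift_natr //; lia.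
Qed.

(** Going forth, it is the last vertex of the gap. *)
Lemma forth_two : forth I (a + d1%:R - 1) = l1.
Proof.
case: (hI) => h0 hs _; rewrite /forth (two_peaks hn hI).
have E s : a + d1%:R - 1 + s%:R = a - 1 + (d1 + s)%:R.
  by rewrite natrD addrA [a - 1 + _]addrAC.
apply: find_iota; first by lia.
  by rewrite E addrAC set22.
by move=> s sd; rewrite E [a + _ - 1]addrAC !inE eq_shift_natr0 ?eq_shift_natr //; lia.
Qed.

End Distances.

Section Syzygies.
Variables (F : fieldType) (n k : nat) (hn : (1 < n)%N) (hk : (0 < k < n)%N).
Local Notation P := (proj_sort F n k).
Local Notation L := (L_module F hn hk).
Local Notation U := (L_unit F hn hk).
Local Notation Psi := (l_to_p F hn hk).
Local Notation pw := (pw F n k).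

Lemma l_to_p_X j s : (s <= k)%N ->
  Psi j (U (pset hn hk j) (j + s%:R)) = pw (nseq s true).
Proof. by move=> sk; rewrite -(@p_to_l_X F) // p_to_lK. Qed.

Lemma l_to_p_Y j r : (r <= n - k)%N ->
  Psi j (U (pset hn hk j) (j - r%:R)) = pw (nseq r false).
Proof. by move=> rk; rewrite -(@p_to_l_Y F) // p_to_lK. Qed.

Lemma Omega1_iso (I J : ksubset n k) a d1 l1 d2 l2 :
  two_intervals (val I) a d1 l1 d2 l2 -> val J = syzset a d1 l1 d2 ->
  biso (Omega1 F hn hk I) (L J).
Proof.
move=> hI hJ; have hS := two_peaks hn hI.
have coverE f : Defs.cover F hn hk I f =
    weighted_cover hn hk I (peaks (val I)) (fun=> 1) f.
  rewrite /Defs.cover /weighted_cover (_ : (fun j => 1 *: _) = U I) //.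
  by apply/funext => j; rewrite scale1r.
apply: (@biso_bker F n k _ _ _ _ (cover_hom F hn hk I)
  (syz_incl hn hk J d2 l2 (fun=> 1) hS)).
- exact: (syz_incl_bhom hn hk hI hJ).
- exact: (syz_incl_inj (oner_neq0 F)).
- by move=> h; rewrite coverE; exact: (weighted_cover_syz_incl hI (fun=> 1) hS h).
- by move=> f f0; apply: (weighted_cover_exact J hI hS (c := fun=> 1));
    rewrite ?oner_neq0 -?coverE.
Qed.

Section SecondSyzygy.
Variables (I J : ksubset n k) (a : 'Z_n) (d1 l1 d2 l2 : nat).
Hypothesis hI : two_intervals (val I) a d1 l1 d2 l2.
Hypothesis hJ : val J = syzset a d1 l1 d2.

Local Notation v1 := (a + d1%:R - 1).
Local Notation v2 := (a + d1%:R + (d2 + l1)%:R - 1).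
Local Notation hS := (two_peaks hn hI).
Local Notation inc := (syz_incl hn hk J d2 l2 (fun=> 1) hS).
Local Notation PU := (psum F hn hk (peaks (val I))).
Local Notation PV := (psum F hn hk (valleys (val I))).
Local Notation T := {j | j \in peaks (val I)}.

(** The inclusion of L_J sends the unit at v1 to the generator of D at v1, but the
    unit at v2 to minus the generator at v2: its component in P_u1 is positive and
    that in P_u2 negative at both valleys, whereas D puts the positive sign on the
    peak that precedes the valley. *)
Definition vsign (v : 'Z_n) : F := if v == v1 then 1 else -1.

Lemma valley_pair : valleys (val I) = [set v1; v2].
Proof.
rewrite (two_valleys hn hI); congr [set _; _]; rewrite -[_ + (d2 + l1)%:R]addrA -natrD.
by congr (_ + _%:R - 1); lia.
Qed.

Lemma v2E : v2 = a + (d1 + l1)%:R + d2%:R - 1.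
Proof. rewrite -[_ + (d2 + l1)%:R]addrA -[_ + d2%:R]addrA -!natrD.
by congr (_ + _%:R - 1); lia. Qed.

Lemma v2_neq : v2 != v1.
Proof. by case: hI => h0 hs _; rewrite addrAC eq_shift_natr0 //; lia. Qed.

Lemma peak_neq_sym : a + (d1 + l1)%:R - 1 != a - 1.
Proof. by rewrite eq_sym; exact: (peak_neq hn hI). Qed.

Lemma back_v1 : v1 - (back (val I) v1)%:R = a - 1.
Proof. by rewrite (back_two hn hI) addrAC addrK. Qed.

Lemma forth_v1 : v1 + (forth (val I) v1)%:R = a + (d1 + l1)%:R - 1.
Proof. by rewrite (forth_two hn hI) addrAC -[_ + l1%:R]addrA -natrD. Qed.

Lemma back_v2 : v2 - (back (val I) v2)%:R = a + (d1 + l1)%:R - 1.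
Proof. by rewrite v2E (back_two hn (two_rot hn hI)) addrAC addrK. Qed.

Lemma forth_v2 : v2 + (forth (val I) v2)%:R = a - 1.
Proof.
case: (hI) => h0 hs _; rewrite v2E (forth_two hn (two_rot hn hI)) addrAC.
rewrite -[_ + d2%:R]addrA -[_ + l2%:R]addrA -!natrD (_ : (_ + _)%N = n); last lia.
by rewrite (natr_n hn) addr0.
Qed.

Lemma inc_valley_unit v : v \in valleys (val I) ->
  inc (vsign v *: U J v) = Dgen F hn hk I v.
Proof.
have [h0 hs _] := hI; have kE := k_sum hn hI.
rewrite valley_pair !inE /vsign => /orP[] /eqP ->.
- rewrite eqxx scale1r /Dgen back_v1 forth_v1 (back_two hn hI) (forth_two hn hI).
  apply/ffunP => s; have [->|->] := peak_cases hS s.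
  + rewrite syz_incl1 scale1r (@xpow_map_unit F n k hn hk J (pset hn hk (a - 1))).
      rewrite [a + _ - 1]addrAC l_to_p_X; last lia.
      by rewrite !ffunE /= eqxx (negPf (peak_neq hn hI)) subr0.
    have := cover_exp0_back hn (two_rot hn hI) (leqnn l1); rewrite natrD addrA.
    by rewrite [_ - 1 - _]addrAC addrK.
  + rewrite (syz_incl2 hI) scaleN1r.
    rewrite (@xpow_map_unit F n k hn hk J (pset hn hk (a + (d1 + l1)%:R - 1))).
      rewrite (_ : v1 = a + (d1 + l1)%:R - 1 - l1%:R); last first.
        by rewrite natrD addrA [_ - 1 - _]addrAC addrK.
      rewrite l_to_p_Y; last lia.
      by rewrite !ffunE /= eqxx (negPf peak_neq_sym) sub0r.
    by have := cover_exp0 hn hI (leqnn d1); rewrite addrAC.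
- rewrite (negPf v2_neq) scaleN1r linearN /Dgen back_v2 forth_v2.
  rewrite v2E (back_two hn (two_rot hn hI)) (forth_two hn (two_rot hn hI)).
  have v2E' : a + (d1 + l1)%:R + d2%:R - 1 = a - 1 - l2%:R.
    rewrite -[_ + d2%:R]addrA -natrD addrAC; congr (_ + _).
    by apply/eqP; rewrite -addr_eq0 -natrD hs (natr_n hn).
  apply/ffunP => s; rewrite [LHS]ffunE; have [->|->] := peak_cases hS s.
  + rewrite syz_incl1 scale1r (@xpow_map_unit F n k hn hk J (pset hn hk (a - 1))).
      rewrite v2E' l_to_p_Y; last lia.
      by rewrite !ffunE /= eqxx (negPf (peak_neq hn hI)) sub0r.
    by have := cover_exp0 hn (two_rot hn hI) (leqnn d2); rewrite addrAC.
  + rewrite (syz_incl2 hI) scaleN1r opprK.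
    rewrite (@xpow_map_unit F n k hn hk J (pset hn hk (a + (d1 + l1)%:R - 1))).
      rewrite [_ + d2%:R - 1]addrAC l_to_p_X; last lia.
      by rewrite !ffunE /= eqxx (negPf peak_neq_sym) subr0.
    by rewrite v2E'; exact: (cover_exp0_back hn hI (leqnn l2)).
Qed.

(** Both sides are homomorphisms that agree on the generators e_v. *)
Lemma Dmap_factor f :
  Dmap F hn hk I f = inc (weighted_cover hn hk J (valleys (val I)) vsign f).
Proof.
rewrite /Dmap /weighted_cover !psum_homE linear_sum; apply: eq_bigr => v _.
have [_ ix iy] := syz_incl_bhom hn hk hI hJ (fun=> 1 : F) hS.
set x := f v; pose g := vsign (val v) *: U J (val v).
have gE c b : from_proj g (pcons F n k c b) =
    (if c then vx _ else vy _) (from_proj g b).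
  exact: from_proj_pcons.
rewrite -[RHS]/((inc \o from_proj g) x) -[LHS]/(from_proj (Dgen F hn hk I (val v)) x).
apply/esym; apply: from_proj_uniq.
  by move=> c b; rewrite !lcompE gE; case: c; rewrite ?ix ?iy.
by rewrite lcompE from_projE [act _ _]/= inc_valley_unit //; exact: (valP v).
Qed.

End SecondSyzygy.

(** As the inclusion of L_J is injective, the kernel of D is the kernel of the
    signed cover of L_J, hence L_(J') with J' obtained from J as J from I. Both
    intervals have been swapped twice and moved by d1 + d2 = k. *)
Lemma Omega2_iso (I J : ksubset n k) a d1 l1 d2 l2 :
  two_intervals (val I) a d1 l1 d2 l2 ->
  two_intervals (val J) (a + k%:R) d1 l1 d2 l2 ->
  biso (Omega2 F hn hk I) (L J).
Proof.
move=> hI hJ; have kE := k_sum hn hI.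
have cI1 : #|syzset a d1 l1 d2| == k by rewrite (card_two hn (two_syz hn hI)) kE addnC.
pose I1 : ksubset n k := exist _ (syzset a d1 l1 d2) cI1.
have hI1 : two_intervals (val I1) (a + d1%:R) d2 l1 d1 l2 := two_syz hn hI.
have hJ1 : val J = syzset (a + d1%:R) d2 l1 d1.
  by case: hJ => _ _ ->; rewrite kE natrD addrA.
have vE := valley_pair hI.
have c1 : vsign a d1 (a + d1%:R - 1) != 0 by rewrite /vsign eqxx oner_neq0.
have c2 : vsign a d1 (a + d1%:R + (d2 + l1)%:R - 1) != 0.
  by rewrite /vsign (negPf (v2_neq hI)) oppr_eq0 oner_neq0.
have DE := Dmap_factor (J := I1) hI erefl.
apply: (@biso_bker F n k _ _ _ _ (Dmap_hom F hn hk I)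
  (syz_incl hn hk J d1 l2 (vsign a d1) vE)).
- exact: (syz_incl_bhom hn hk hI1 hJ1).
- exact: (syz_incl_inj c2).
- by move=> h; rewrite DE (weighted_cover_syz_incl hI1) linear0.
- move=> f f0; apply: (weighted_cover_exact J hI1 vE c1 c2).
  pose j1 := syz_incl hn hk I1 d2 l2 (fun=> 1 : F) (two_peaks hn hI).
  have inj : injective j1 := syz_incl_inj (oner_neq0 F).
  by apply: inj; rewrite linear0 -[RHS]f0 DE.
Qed.

End Syzygies.

(** * The period *)

Section Period.
Variables (F : fieldType) (n k : nat) (hn : (1 < n)%N) (hk : (0 < k < n)%N).
Local Notation L := (L_module F hn hk).

(** The set attached to Omega^m(L_I): two steps move I by k, and one more step swaps
    the lengths of the intervals and moves the start by d1. *)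
Definition syz_shape (J : {set 'Z_n}) a d1 l1 d2 l2 m : Prop :=
  if odd m then two_intervals J (a + (d1 + m./2 * k)%:R) d2 l1 d1 l2
  else two_intervals J (a + (m./2 * k)%:R) d1 l1 d2 l2.

Lemma syz_shape_SS (J : {set 'Z_n}) a d1 l1 d2 l2 m :
  syz_shape J (a + k%:R) d1 l1 d2 l2 m -> syz_shape J a d1 l1 d2 l2 m.+2.
Proof.
rewrite /syz_shape /= negbK; case: odd; rewrite -addrA -natrD.
  by rewrite (_ : (k + (d1 + m./2 * k) = d1 + m./2.+1 * k)%N) //; lia.
by rewrite -mulSn.
Qed.

Lemma ex_two (a : 'Z_n) d1 l1 d2 l2 :
  [&& 0 < d1, 0 < l1, 0 < d2 & 0 < l2]%N -> (d1 + l1 + d2 + l2 = n)%N ->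
  k = (d1 + d2)%N -> exists J : ksubset n k, two_intervals (val J) a d1 l1 d2 l2.
Proof.
move=> h0 hs kE; pose A := cint a d1 :|: cint (a + (d1 + l1)%:R) d2.
have hA : two_intervals A a d1 l1 d2 l2 by [].
have cA : #|A| == k by rewrite (card_two hn hA) kE.
by exists (exist _ A cA).
Qed.

Lemma shift_two (I : ksubset n k) a d1 l1 d2 l2 b :
  two_intervals (val I) a d1 l1 d2 l2 ->
  exists J : ksubset n k, two_intervals (val J) b d1 l1 d2 l2.
Proof.
by move=> hI; case: (hI) => h0 hs _; apply: ex_two => //; exact: (k_sum hn hI).
Qed.

Lemma syz_two (I : ksubset n k) a d1 l1 d2 l2 :
  two_intervals (val I) a d1 l1 d2 l2 ->
  exists2 J : ksubset n k, val J = syzset a d1 l1 d2 &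
    two_intervals (val J) (a + d1%:R) d2 l1 d1 l2.
Proof.
move=> hI; case: (two_syz hn hI) => h0 hs _.
have [|J hJ] := ex_two (a + d1%:R) h0 hs; first by rewrite (k_sum hn hI) addnC.
by exists J => //; case: hJ.
Qed.

(** In the inductive case the module L_K isomorphic to Omega^2(L_I) is given, and
    K is the translate of I because L_K determines K. *)
Lemma syzygy_shape (I : ksubset n k) m M a d1 l1 d2 l2 :
  syzygy hn hk I m M -> two_intervals (val I) a d1 l1 d2 l2 ->
  exists2 J, biso M (L J) & syz_shape (val J) a d1 l1 d2 l2 m.
Proof.
move=> hM; elim: hM a => {I m M} [I|I|I K m M IK _ IH] a hI.
- have [J JE hJ] := syz_two hI; exists J; first exact: Omega1_iso hI JE.
  by rewrite /syz_shape /= addn0.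
- have [J hJ] := shift_two (a + k%:R) hI; exists J; first exact: Omega2_iso hI hJ.
  by rewrite /syz_shape /= mul1n.
- have [K' hK'] := shift_two (a + k%:R) hI.
  have KE : K = K'.
    apply: (@L_iso_inj F n k hn hk); apply: biso_trans (biso_sym IK) _.
    exact: Omega2_iso hI hK'.
  rewrite -KE in hK'; have [J MJ hJ] := IH _ hK'.
  by exists J => //; exact: syz_shape_SS.
Qed.

Lemma syzygy_ex (I : ksubset n k) m a d1 l1 d2 l2 :
  two_intervals (val I) a d1 l1 d2 l2 -> (0 < m)%N ->
  exists M : bmod F n k, syzygy hn hk I m M.
Proof.
elim/ltn_ind: m I a => -[|[|[|m]]] IH I a hI // _.
- by exists (Omega1 F hn hk I); constructor.
- by exists (Omega2 F hn hk I); constructor.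
have [J hJ] := shift_two (a + k%:R) hI.
have [|M hM] := IH m.+1 _ J _ hJ isT; first by [].
by exists M; apply: SyzygySS hM; exact: Omega2_iso hI hJ.
Qed.

Lemma two_inj (I J : ksubset n k) a d1 l1 d2 l2 :
  two_intervals (val I) a d1 l1 d2 l2 -> two_intervals (val J) a d1 l1 d2 l2 -> I = J.
Proof. by move=> [_ _ IE] [_ _ JE]; apply: val_inj; rewrite IE JE. Qed.

(** The set of [syz_shape] is unique, so if it is I, the syzygy is isomorphic to
    L_I, and conversely by [L_iso_inj]. *)
Lemma periodic_iff (I : ksubset n k) m a d1 l1 d2 l2 :
  two_intervals (val I) a d1 l1 d2 l2 -> (0 < m)%N ->
  (exists2 M : bmod F n k, syzygy hn hk I m M & biso M (L I)) <->
  syz_shape (val I) a d1 l1 d2 l2 m.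
Proof.
move=> hI m0; split=> [[M hM MI]|hm].
  have [J MJ hJ] := syzygy_shape hM hI.
  suff -> : I = J by [].
  by apply: (@L_iso_inj F n k hn hk); apply: biso_trans (biso_sym MI) MJ.
have [M hM] := syzygy_ex hI m0; exists M => //.
have [J MJ hJ] := syzygy_shape hM hI.
suff -> : I = J by [].
by move: hm hJ; rewrite /syz_shape; case: odd; exact: two_inj.
Qed.

Lemma eqn_natr p q : ((p%:R : 'Z_n) == q%:R) = (p == q %[mod n]).
Proof. by rewrite -val_eqE /= !val_Zp_nat. Qed.

Lemma two_swap_iff (I : {set 'Z_n}) a d1 l1 d2 l2 p :
  two_intervals I a d1 l1 d2 l2 ->
  two_intervals I (a + p%:R) d2 l1 d1 l2 <->
  (d1 = d2 /\ p = 0 %[mod n]) \/ (l1 = l2 /\ p = d1 + l1 %[mod n])%N.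
Proof.
move=> hI; split.
- move=> /(two_eq hn hI) [[/eqP E d21 _ _]|[/eqP E _ l12 _]].
    by left; split=> //; apply/eqP; rewrite -eqn_natr -(inj_eq (addrI a)) addr0.
  by right; split=> //; apply/eqP; rewrite -eqn_natr -(inj_eq (addrI a)).
- case=> -[E /eqP]; rewrite -eqn_natr => /eqP ->.
    by rewrite addr0 -E; rewrite -E in hI.
  by move: (two_rot hn hI); rewrite -E.
Qed.

Lemma two_shift_iff (I : {set 'Z_n}) a d1 l1 d2 l2 p :
  two_intervals I a d1 l1 d2 l2 ->
  two_intervals I (a + p%:R) d1 l1 d2 l2 <->
  p = 0 %[mod n] \/ ((d1 = d2 /\ l1 = l2) /\ p = d1 + l1 %[mod n])%N.
Proof.
move=> hI; split.
- move=> /(two_eq hn hI) [[/eqP E _ _ _]|[/eqP E d12 l12 _]].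
    by left; apply/eqP; rewrite -eqn_natr -(inj_eq (addrI a)) addr0.
  by right; split=> //; apply/eqP; rewrite -eqn_natr -(inj_eq (addrI a)).
- case=> [/eqP|[[d12 l12] /eqP]]; rewrite -eqn_natr => /eqP ->.
    by rewrite addr0.
  by move: (two_rot hn hI); rewrite -d12 -l12.
Qed.

(** By [two_eq] there are two ways in which the tuple of Omega^m(L_I) can describe
    I. In all four cases t > 0 is automatic: for even m as m > 0, and for odd m
    because t = 0 would mean that n divides d1 or l1, which lie strictly between 0 and n. The last congruence uses
    that 2 (d1 + l1) = n when the intervals are exchanged by a rotation. *)
Lemma syz_shape_iff (I : {set 'Z_n}) m a d1 l1 d2 l2 :
  two_intervals I a d1 l1 d2 l2 -> (0 < m)%N ->
  syz_shape I a d1 l1 d2 l2 m <->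
  ((exists t, [/\ (0 < t)%N, (n %| t * k)%N & m = (2 * t)%N]) \/
   (l1 = l2 /\ exists t, [/\ (0 < t)%N, t * k = l2 %[mod n] & m = (2 * t + 1)%N])) \/
  ((d1 = d2 /\ exists t, [/\ (0 < t)%N, d1 + t * k = 0 %[mod n] & m = (2 * t + 1)%N]) \/
   ((d1 = d2 /\ l1 = l2) /\
    exists t, [/\ (0 < t)%N, d1 + l1 + t * k = 0 %[mod n] & m = (2 * t)%N])).
Proof.
move=> hI m0; have [h0 hs _] := hI; set t := m./2.
have mE : m = (odd m + 2 * t)%N by rewrite mul2n odd_double_half.
have dvdE p : (n %| p)%N <-> p = 0 %[mod n].
  by rewrite mod0n; split=> [/eqP|/eqP].
have nz p : (0 < p < n)%N -> p <> 0 %[mod n].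
  by move=> pn; rewrite mod0n modn_small; lia.
have cancel p q r : (p + q = p + r %[mod n] <-> q = r %[mod n])%N.
  by split=> /eqP E; apply/eqP; move: E; rewrite eqn_modDl.
rewrite /syz_shape -/t; case: (boolP (odd m)) mE => om mE.
- rewrite (two_swap_iff _ hI); split.
  + case=> -[E1 E2].
      right; left; split=> //; exists t; split=> //; last by lia.
      by rewrite lt0n; apply/eqP => t0; move: E2; rewrite t0 addn0; apply: nz; lia.
    move: E2 => /cancel E2; left; right; split=> //; exists t; split; last 2 first.
    * by rewrite -E1.
    * by lia.
    by rewrite lt0n; apply/eqP => t0; move: E2; rewrite t0 => /esym; apply: nz; lia.
  + have tE u : m = (2 * u + 1)%N -> t = u by clear -mE; lia.
    have nE u : m <> (2 * u)%N by clear -mE; lia.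
    case=> [[[u [_ _ /nE //]]|[E1 [u [_ E /tE ->]]]]|
            [[E1 [u [_ E /tE ->]]]|[_ [u [_ _ /nE //]]]]].
      by right; split=> //; apply/cancel; rewrite E1.
    by left.
- have halfE : (d1 = d2 -> l1 = l2 ->
      (t * k = d1 + l1 %[mod n] <-> d1 + l1 + t * k = 0 %[mod n]))%N.
    move=> d12 l12; rewrite -(cancel (d1 + l1)%N).
    have -> : (d1 + l1 + (d1 + l1) = n)%N by lia.
    by rewrite modnn mod0n.
  have {}mE : m = (2 * t)%N by clear -mE; lia.
  have t0 : (0 < t)%N by clear -m0 mE; lia.
  rewrite (two_shift_iff _ hI); split.
  + case=> [/dvdE E|[[E1 E2] E]]; [left; left|right; right; split=> //];
      exists t; split=> //.
    exact/(halfE E1 E2).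
  + have tE u : m = (2 * u)%N -> t = u by clear -mE; lia.
    have nE u : m <> (2 * u + 1)%N by clear -mE; lia.
    case=> [[[u [_ E /tE ->]]|[_ [u [_ _ /nE //]]]]|
            [[_ [u [_ _ /nE //]]]|[[E1 E2] [u [_ E /tE tu]]]]].
      by left; apply/dvdE.
    by right; split=> //; apply/(halfE E1 E2); rewrite tu.
Qed.

End Period.

Local Open Scope nat_scope.

Theorem theorem2p4 (F : closedFieldType) (n k : nat)
    (hn : 1 < n) (hk : 0 < k < n) (I : ksubset n k)
    (a : 'Z_n) (d1 l1 d2 l2 : nat)
    (hI : two_intervals (val I) a d1 l1 d2 l2) :
  let m0 := Some (2 * n %/ gcdn n k) in
  let odd_d := omap (fun t => 2 * t + 1)
                 (min_pos (fun t => d1 + t * k = 0 %[mod n])) in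
  let odd_l := omap (fun t => 2 * t + 1)
                 (min_pos (fun t => t * k = l2 %[mod n])) in
  let even_dl := omap (fun t => 2 * t)
                 (min_pos (fun t => d1 + l1 + t * k = 0 %[mod n])) in
  [/\ d1 <> d2 -> l1 <> l2 -> period F hn hk I = m0,
      d1 = d2 -> l1 <> l2 -> period F hn hk I = omin m0 odd_d,
      d1 <> d2 -> l1 = l2 -> period F hn hk I = omin m0 odd_l &
      d1 = d2 -> l1 = l2 ->
        period F hn hk I = omin (omin m0 odd_l) (omin odd_d even_dl)].
Proof.
have even_map P : omap (fun t => 2 * t) (min_pos P) =
    min_pos (fun m => exists t, [/\ 0 < t, P t & m = 2 * t]).
  by rewrite min_pos_map // => t; [move=> u; rewrite leq_mul2l|rewrite muln_gt0].
have odd_map P : omap (fun t => 2 * t + 1) (min_pos P) =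
    min_pos (fun m => exists t, [/\ 0 < t, P t & m = 2 * t + 1]).
  by rewrite min_pos_map // => t; [move=> u; rewrite leq_add2r leq_mul2l|rewrite addn1].
have -> : Some (2 * n %/ gcdn n k) =
    min_pos (fun m => exists t, [/\ 0 < t, n %| t * k & m = 2 * t]).
  by rewrite -even_map min_pos_dvd ?(ltnW hn) //= muln_divA // dvdn_gcdl.
rewrite even_map !odd_map /=.
have periodE m (m0 : 0 < m) :=
  iff_trans (periodic_iff F hn hk hI m0) (syz_shape_iff hn hk hI m0).
by split=> d12 l12; rewrite -?min_pos_or; apply: eq_min_pos => m /periodE ->; tauto.
Qed.
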